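(* Assume the $Y_i$ satisfy conditions (A)–(C) below for some $w,u>0$. For $t\ge2$ and $g\in[t-1]$ let $\tilde\Sigma^{(t)}_{1,g}=2^{-\lfloor\log_2g\rfloor}\sum_{i=1}^{2^{\lfloor\log_2 g\rfloor}}Y_iY_i^\top$, $\tilde\Sigma^{(t)}_{2,g}=g^{-1}\sum_{i=t-g+1}^tY_iY_i^\top$, $(\hat\sigma^{(t)}_g)^2=\hat\lambda^1_{\max}(\tilde\Sigma^{(t)}_{1,g})$, $\xi^{(t)}_{g,s}=\lambda s\{\sqrt{\log(p\vee t)/g}\vee\log(p\vee t)/g\}$ with $\lambda>0$, $$T^{(t)}_g=\mathbb 1\Big\{\max_{s\in\mathcal S}\frac{\hat\lambda^s_{\max}(\tilde\Sigma^{(t)}_{1,g}-\tilde\Sigma^{(t)}_{2,g})}{(\hat\sigma^{(t)}_g)^2\xi^{(t)}_{g,s}}>1\Big\},\quad \mathcal S=\{2^0,2^1,\dots,2^{\lfloor\log_2p\rfloor}\}\cup\{p\},$$ and $\hat\tau=\inf\{t\ge2:\max_{g\in G^{(t)},\,g\le t/2}T^{(t)}_g>0\}$. For every $\delta\in(0,1)$ there exist a constant $C_1>0$ depending only on $\delta,w,u$ and a constant $C_2>0$ depending only on $\delta,w,u,\lambda$ such that: if $\lambda\ge C_1$ then $\mathbb P_\infty(\hat\tau<\infty)\le\delta$; and if $\tau<\infty$ and for some $k\in[p]$, $\tau\omega_k^2\ge C_2k^2\log(p\vee2\tau)$, then $$\mathbb P_\tau\Big(\hat\tau\le\tau+\Big\lceil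 C_2k^2\frac{\log(p\vee2\tau)}{\omega_k^2}\Big\rceil\Big)\ge1-\delta.$$
   Context: $\log$ natural, $[n]=\{1,\dots,n\}$, $\inf\emptyset=\infty$, $\mathbb S^{p-1}$ the Euclidean unit sphere, $\mathbb S^{p-1}_s$ its subset of vectors with at most $s$ nonzero entries, $\|X\|_{\psi_2}=\inf\{r>0:\mathbb E\exp(X^2/r^2)\le2\}$. For symmetric $A\in\mathbb R^{p\times p}$: $\lambda^s_{\max}(A)=\sup_{v\in\mathbb S^{p-1}_s}|v^\top Av|$ and $\hat\lambda^s_{\max}(A)=\sup_{Z\in N(p,s)}|\mathrm{Tr}(AZ)|$, where $N(p,s)=\{Z\in\mathbb R^{p\times p}: Z\succeq0,\ \mathrm{Tr}(Z)=1,\ \sum_{i,j}|Z_{ij}|\le s\}$. Model: $(Y_i)_{i\in\mathbb N}$ random vectors in $\mathbb R^p$; under $\mathbb P_\tau$ ($\tau\in\mathbb N\cup\{\infty\}$), $Y_i\sim P_1$ for $i\le\tau$, $Y_i\sim P_2$ for $i>\tau$, with positive definite $\Sigma_1=\mathbb E_{P_1}YY^\top$, $\Sigma_2=\mathbb E_{P_2}YY^\top$; $\omega_s=\lambda^s_{\max}(\Sigma_1-\Sigma_2)/\{\lambda^s_{\max}(\Sigma_1)\vee\lambda^s_{\max}(\Sigma_2)\}$. Conditions: (A) the $Y_i$ are independent and mean zero; (B) for all $i$ and $v\in\mathbb S^{p-1}$, $v^\top Y_i/\{\mathbb E(v^\top Y_iY_i^\top v)\}^{1/2}$ has a continuous density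 bounded above by $w$; (C) for all $i$ and $v\in\mathbb S^{p-1}$, $\|v^\top Y_i\|_{\psi_2}^2\le u\,\mathbb E\{(v^\top Y_i)^2\}$. Dynamic geometric grid: for $t\ge2$, $G^{(t)}=\{1\}\cup\bigcup_{j=1}^{\lfloor \log_2\{(t-1)/3\}\rfloor+1}\{g^{(t)}_{L,j}\}\cup\bigcup_{j=1}^{\lfloor\log_2(t-1)\rfloor-1}\{g^{(t)}_{R,j}\}$, $g^{(t)}_{L,j}=2^j+\{(t-1)\bmod 2^{j-1}\}$, $g^{(t)}_{R,j}=g^{(t)}_{L,j}+2^{j-1}$ (empty unions if upper index $<1$). *)

(* Defs.v *)
From HB Require Import structures.
From mathcomp Require Import all_boot all_order all_algebra.
From mathcomp Require Import all_classical all_reals all_analysis.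
Set Implicit Arguments. Unset Strict Implicit. Unset Printing Implicit Defensive.
Import Order.TTheory GRing.Theory Num.Theory.
Import numFieldNormedType.Exports.
Local Open Scope classical_set_scope.
Local Open Scope ring_scope.

Section Mx.
Variables (R : realType) (p : nat).

Definition qform (A : 'M[R]_p) (v : 'cV[R]_p) : R := (v^T *m A *m v) 0 0.

Definition unit_sphere : set 'cV[R]_p := [set v | \sum_i v i 0 ^+ 2 = 1].

Definition sparse_sphere (s : nat) : set 'cV[R]_p :=
  [set v | v \in unit_sphere /\ (#|[set i : 'I_p | v i ord0 != 0%R]| <= s)%N].

Definition lmax (s : nat) (A : 'M[R]_p) : R :=
  sup [set `|qform A v| | v in sparse_sphere s].

Definition psd (Z : 'M[R]_p) : Prop := Z^T = Z /\ forall v, 0 <= qform Z v.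

Definition posdef (S : 'M[R]_p) : Prop :=
  S^T = S /\ forall v : 'cV[R]_p, v != 0 -> 0 < qform S v.

Definition Nps (s : nat) : set 'M[R]_p :=
  [set Z | psd Z /\ \tr Z = 1 /\ \sum_i \sum_j `|Z i j| <= s%:R].

Definition lhat (s : nat) (A : 'M[R]_p) : R :=
  sup [set `|\tr (A *m Z)| | Z in Nps s].

Definition omega (s : nat) (S1 S2 : 'M[R]_p) : R :=
  lmax s (S1 - S2) / Num.max (lmax s S1) (lmax s S2).

End Mx.
Arguments unit_sphere {R p}.
Arguments sparse_sphere {R p}.
Arguments Nps {R p}.

(* Probabilistic notions.  A random vector Y_i in R^p is given by its    *)
(* p real coordinates Y i j : T -> R (j : 'I_p). Indices i start at 1.  *)
Section Prob.
Context {R : realType} {d : measure_display} {T : measurableType d}.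
Variable (P : probability T R).
Variable (p : nat).

Local Open Scope ereal_scope.

Definition vecY (Y : nat -> 'I_p -> T -> R) (i : nat) (x : T) : 'cV[R]_p :=
  \col_j Y i j x.

Definition proj (Y : nat -> 'I_p -> T -> R) (i : nat) (v : 'cV[R]_p) : T -> R :=
  fun x => (\sum_j v j 0 * Y i j x)%R.

(* E[X Z] (real number; used only under square integrability) *)
Definition E2 (X Z : T -> R) : R := fine (\int[P]_x (X x * Z x)%:E).

Definition Sigma (Y : nat -> 'I_p -> T -> R) (i : nat) : 'M[R]_p :=
  \matrix_(j, k) E2 (Y i j) (Y i k).

(* mutual independence of the random vectors (Y_i)_{i >= 1}: product rule
   on every finite family of indices and every family of cylinder
   (product of Borel sets) events; cylinders form a pi-system generating
   sigma(Y_i), so this is independence of the random vectors. *)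
Definition indep_vectors (Y : nat -> 'I_p -> T -> R) : Prop :=
  forall (I : seq nat) (B : nat -> 'I_p -> set R),
    uniq I -> all (fun i => 0 < i)%N I ->
    (forall i j, measurable (B i j)) ->
    P [set x | forall i, i \in I -> forall j, B i j (Y i j x)]
    = \prod_(i <- I) P [set x | forall j, B i j (Y i j x)].

Definition same_law (Y : nat -> 'I_p -> T -> R) (i k : nat) : Prop :=
  forall B : 'I_p -> set R, (forall j, measurable (B j)) ->
    P [set x | forall j, B j (Y i j x)] = P [set x | forall j, B j (Y k j x)].

(* ||X||_{psi_2} = inf{r > 0 : E exp(X^2/r^2) <= 2}, inf of empty = +oo *)
Definition psi2 (X : T -> R) : \bar R :=
  ereal_inf [set r%:E | r in [set r : R | (0 < r)%R /\
       \int[P]_x (expR (X x ^+ 2 / r ^+ 2))%:E <= 2%:E]].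

Definition cont_density_bounded (X : T -> R) (w : R) : Prop :=
  exists f : R -> R, continuous f /\ (forall y, (0 <= f y <= w)%R) /\
    forall B : set R, measurable B ->
      P (X @^-1` B) = \int[lebesgue_measure]_(y in B) (f y)%:E.

(* Basic regularity: measurable coordinates with finite second moments
   (so that Sigma is well defined), for all i >= 1. *)
Definition regular (Y : nat -> 'I_p -> T -> R) : Prop :=
  forall i, (0 < i)%N -> forall j,
    measurable_fun setT (Y i j) /\
    P.-integrable setT (fun x => (Y i j x ^+ 2)%:E).

Definition condA (Y : nat -> 'I_p -> T -> R) : Prop :=
  indep_vectors Y /\
  forall i, (0 < i)%N -> forall j, \int[P]_x (Y i j x)%:E = 0.

Definition condB (Y : nat -> 'I_p -> T -> R) (w : R) : Prop :=
  forall i, (0 < i)%N -> forall v, v \in unit_sphere ->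
    cont_density_bounded
      (fun x => proj Y i v x / Num.sqrt (E2 (proj Y i v) (proj Y i v)))%R w.

Definition condC (Y : nat -> 'I_p -> T -> R) (u : R) : Prop :=
  forall i, (0 < i)%N -> forall v, v \in unit_sphere ->
    psi2 (proj Y i v) * psi2 (proj Y i v)
      <= u%:E * \int[P]_x ((proj Y i v x) ^+ 2)%:E.

Definition model_infty (Y : nat -> 'I_p -> T -> R) (w u : R) : Prop :=
  regular Y /\ condA Y /\ condB Y w /\ condC Y u /\
  (forall i, (0 < i)%N -> same_law Y i 1) /\
  posdef (Sigma Y 1).

Definition model_tau (Y : nat -> 'I_p -> T -> R) (tau : nat) (w u : R) : Prop :=
  regular Y /\ condA Y /\ condB Y w /\ condC Y u /\
  (forall i, (0 < i <= tau)%N -> same_law Y i 1) /\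
  (forall i, (tau < i)%N -> same_law Y i tau.+1) /\
  posdef (Sigma Y 1) /\ posdef (Sigma Y tau.+1).

End Prob.

(* number of left points: floor(log2((t-1)/3)) + 1 if >= 1, else 0 *)
Definition nL (t : nat) : nat :=
  if (3 <= t.-1)%N then (trunc_log 2 (t.-1 %/ 3)).+1 else 0.
(* number of right points: floor(log2(t-1)) - 1 (0 if negative) *)
Definition nR (t : nat) : nat := (trunc_log 2 t.-1 - 1)%N.
Definition gL (t j : nat) : nat := (2 ^ j + (t.-1 %% 2 ^ j.-1))%N.
Definition gR (t j : nat) : nat := (gL t j + 2 ^ j.-1)%N.
Definition grid (t : nat) : seq nat :=
  1%N :: [seq gL t j | j <- iota 1 (nL t)] ++ [seq gR t j | j <- iota 1 (nR t)].

Section Stat.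
Context {R : realType} {T : Type}.
Variables (p : nat) (lam : R) (Y : nat -> 'I_p -> T -> R).

Let vY i x : 'cV[R]_p := \col_j Y i j x.

Definition Sig1 (g : nat) (x : T) : 'M[R]_p :=
  let m := (2 ^ trunc_log 2 g)%N in
  (m%:R)^-1 *: \sum_(1 <= i < m.+1) (vY i x *m (vY i x)^T).

Definition Sig2 (t g : nat) (x : T) : 'M[R]_p :=
  (g%:R)^-1 *: \sum_(t - g + 1 <= i < t.+1) (vY i x *m (vY i x)^T).

Definition sighat2 (g : nat) (x : T) : R := lhat 1 (Sig1 g x).

Definition xi (t g s : nat) : R :=
  let L := ln ((maxn p t)%:R) / g%:R in
  lam * s%:R * Num.max (Num.sqrt L) L.

Definition Sset : seq nat :=
  rcons [seq (2 ^ e)%N | e <- iota 0 (trunc_log 2 p).+1] p.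

Definition Tstat (t g : nat) (x : T) : R :=
  if asbool (\big[Num.max/0]_(s <- Sset)
         (lhat s (Sig1 g x - Sig2 t g x) / (sighat2 g x * xi t g s)) > 1)
  then 1 else 0.

Definition alarm_times (x : T) : set nat :=
  [set t | (2 <= t)%N /\
     \big[Num.max/0]_(g <- grid t | (2 * g <= t)%N) Tstat t g x > 0].

(* hat tau = inf of the alarm times (+oo if none) *)
Definition tauhat (x : T) : \bar R :=
  ereal_inf [set (t%:R)%:E | t in alarm_times x].

End Stat.

(* Main.v *)
(* On N(p, s) one has |Tr(A Z)| <= s max |A_ij|, so everything reduces to the
   entrywise deviation of averages of Y_j Y_k, which are sub-exponential by (C):
   by independence and a Bernstein bound, with L = log(p \/ t), all entries of
   both window covariances are within a constant times u M (sqrt(L/g) \/ L/g) of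
   their means, outside an event of probability O((p \/ t)^-n), where M bounds the
   diagonal of the covariance.  The scale estimate is bounded below through a
   single coordinate: by (B) the Laplace transform of the square of a normalised
   coordinate is small, so an average of m such squares is below c with
   probability at most q^m.  Without a change, a union bound over all t, g and
   over all dyadic base windows shows that a large lambda never triggers.  With a
   change, it suffices to look at the single time t = tau + h, h being the allowed
   delay, at a grid point g in [h/4, h], and at a sparsity s in [k, 2k]. *)
Require Import Defs.
From HB Require Import structures.
From mathcomp Require Import all_boot all_order all_algebra.
From mathcomp Require Import all_classical all_reals all_analysis.
From mathcomp Require Import measurable_realfun.
From mathcomp Require Import ring lra zify.
Set Implicit Arguments. Unset Strict Implicit. Unset Printing Implicit Defensive.
Import Order.TTheory GRing.Theory Num.Theory.
Import numFieldNormedType.Exports.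
Local Open Scope classical_set_scope.
Local Open Scope ring_scope.

(** * Independence *)

Section Independence.
Context {R : realType} {d : measure_display} {T : measurableType d}.
Variable P : probability T R.
Local Open Scope ereal_scope.

(** The constants may depend neither on the dimension nor on the law, so the scale of the data has
    to cancel: without a change, the coordinate of largest variance both bounds the deviations and
    bounds the scale estimate from below. That lower bound is the delicate point. For small g the
    base window holds a few observations, however large t is, so its failure probability does not
    decrease with t. Two facts rescue the union bound over all times: base windows are initial
    segments of dyadic length, so that one event per exponent r covers every t and g, and the sum of
    q^(2^r) is at most 2q; and (B) allows q to be as small as desired, at the price of a smaller c,
    which a larger lambda absorbs. With a change, the scale estimate only has to be positive. A
    second obstacle is that independence is given for cylinder events, whereas factorising the
    exponential moments of Y_j Y_k involves general Borel sets of pairs of coordinates. The product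
    rule is therefore first extended from rectangles to Borel sets of the plane. *)

Definition rectangle (C : set (R * R)) :=
  exists A B, [/\ measurable A, measurable B & C = A `*` B].

Lemma measurable_rectangle C : rectangle C -> measurable C.
Proof. by move=> [A [B [mA mB ->]]]; exact: measurableX. Qed.

Lemma measure_eq_rectangle (m1 m2 : {measure set (R * R) -> \bar R}) :
    m1 setT < +oo -> (forall C, rectangle C -> m1 C = m2 C) ->
  forall C, measurable C -> m1 C = m2 C.
Proof.
move=> m1oo m12 C mC.
apply: (measure_unique rectangle (fun=> setT)) => //.
- rewrite measurable_prod_measurableType; congr (<<s _ >>).
  apply/seteqP; split => [_ [A mA [B mB <-]]|_ [A [B [mA mB ->]]]].
    by exists A, B.
  by exists A => //; exists B.
- move=> _ _ [A [B [mA mB ->]]] [A' [B' [mA' mB' ->]]].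
  rewrite -setXI; exists (A `&` A'), (B `&` B'); split => //; exact: measurableI.
- by move=> _; exists setT, setT; rewrite setXTT.
- by rewrite bigcup_const.
Qed.

(** Both sides are finite measures in [C]: the push-forward by [X] of [P] restricted to [E], and the
    law of [X] scaled by [P E]. Rectangles form a generating pi-system. *)
Lemma indep_rectangle (X : T -> R * R) (E : set T) :
    measurable_fun setT X -> measurable E ->
    (forall C, rectangle C -> P (X @^-1` C `&` E) = P (X @^-1` C) * P E) ->
  forall C, measurable C -> P (X @^-1` C `&` E) = P (X @^-1` C) * P E.
Proof.
move=> mX mE XE C mC.
have PEfin : P E \is a fin_num by exact: fin_num_measure.
pose r := NngNum (fine_ge0 (measure_ge0 P E)).
have rE : (r%:num)%:E = P E by rewrite /= fineK.
pose m1 : {measure set (R * R) -> \bar R} := pushforward (mrestr P mE) X.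
pose m2 : {measure set (R * R) -> \bar R} := mscale r (pushforward P X).
have H := @measure_eq_rectangle (m1 mX) (m2 mX).
have -> : P (X @^-1` C) * P E = m2 mX C by rewrite -rE muleC.
have -> : P (X @^-1` C `&` E) = m1 mX C by [].
apply: H => //.
  change (P (X @^-1` setT `&` E) < +oo).
  by rewrite preimage_setT setTI -ge0_fin_numE.
move=> D rD; transitivity (P (X @^-1` D) * P E); first exact: XE.
by rewrite -rE muleC.
Qed.

Variable W : nat -> T -> R * R.

Definition cap (C : nat -> set (R * R)) (I : seq nat) : set T :=
  [set x | forall i, i \in I -> C i (W i x)].

Lemma cap_nil C : cap C [::] = setT.
Proof. by apply/seteqP; split. Qed.

Lemma cap_cons C i I : cap C (i :: I) = W i @^-1` C i `&` cap C I.
Proof.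
apply/seteqP; split => [x H|x [H1 H2] j]; last first.
  by rewrite inE => /orP[/eqP->|/H2].
split; first by apply: H; rewrite mem_head.
by move=> j jI; apply: H; rewrite inE jI orbT.
Qed.

Lemma eq_cap C C' I : {in I, C =1 C'} -> cap C I = cap C' I.
Proof. by move=> CC'; apply/seteqP; split => x H i iI; move: (H i iI); rewrite CC'. Qed.

Lemma eq_mem_cap C I J : I =i J -> cap C I = cap C J.
Proof. by move=> IJ; apply/seteqP; split => x H i iI; apply: H; rewrite ?IJ// -IJ. Qed.

Lemma measurable_cap C I : (forall i, i \in I -> measurable_fun setT (W i)) ->
  (forall i, i \in I -> measurable (C i)) -> measurable (cap C I).
Proof.
elim: I => [|i I IH] mW mC; first by rewrite cap_nil.
rewrite cap_cons; apply: measurableI.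
  rewrite -[X in measurable X]setTI; apply: mW => //; rewrite ?mem_head//.
  by apply: mC; rewrite mem_head.
by apply: IH => j jI; [apply: mW|apply: mC]; rewrite inE jI orbT.
Qed.

Variable Q : pred nat.
Hypothesis mW : forall i, Q i -> measurable_fun setT (W i).

Definition indep_on (K : set (set (R * R))) := forall C I, uniq I -> all Q I ->
  (forall i, i \in I -> K (C i)) ->
  P (cap C I) = \prod_(i <- I) P (W i @^-1` C i).

(** Rectangles give way to Borel sets one index at a time. The induction is on the list [J] of
    indices already carrying Borel sets, for every list [I] of indices still carrying rectangles:
    [indep_rectangle] needs the head of [J] only on rectangles, where that index can be moved to
    [I]. *)
Lemma indep_on_measurable : indep_on rectangle -> indep_on measurable.
Proof.
move=> indepW.
suff H J I C : uniq (J ++ I) -> all Q (J ++ I) ->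
    (forall i, i \in J -> measurable (C i)) ->
    (forall i, i \in I -> rectangle (C i)) ->
    P (cap C (J ++ I)) = \prod_(i <- J ++ I) P (W i @^-1` C i).
  by move=> C I uI QI mC; have := H I [::] C; rewrite cats0; apply.
elim: J I C => [|i J IH] I C /=; first by move=> uI QI _ rC; exact: indepW.
move=> /andP[iJI uJI] /andP[Qi QJI] mC rC.
have mCall k : k \in J ++ I -> measurable (C k).
  rewrite mem_cat => /orP[kJ|/rC/measurable_rectangle//].
  by apply: mC; rewrite inE kJ orbT.
have IH0 : P (cap C (J ++ I)) = \prod_(i <- J ++ I) P (W i @^-1` C i).
  by apply: IH => // k kJ; apply: mC; rewrite inE kJ orbT.
rewrite cap_cons big_cons -IH0; apply: indep_rectangle.
- exact: mW.
- apply: measurable_cap => k kJI; first by apply: mW; exact: (allP QJI).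
  exact: mCall.
- move=> D rD.
  pose C' k := if k == i then D else C k.
  have C'E : {in J ++ I, C' =1 C}.
    by move=> k kJI; rewrite /C'; case: eqP kJI => // ->; rewrite (negbTE iJI).
  have C'i : C' i = D by rewrite /C' eqxx.
  have -> : W i @^-1` D `&` cap C (J ++ I) = cap C' (J ++ i :: I).
    rewrite (@eq_mem_cap C' _ (i :: J ++ I)); last first.
      by move=> k; rewrite !(mem_cat, inE) orbCA.
    by rewrite cap_cons C'i (eq_cap C'E).
  have pm : perm_eq (J ++ i :: I) (i :: J ++ I).
    by rewrite -cat1s perm_catCA.
  rewrite (IH (i :: I) C').
  + rewrite (perm_big _ pm) big_cons C'i IH0; congr (_ * _).
    by apply: eq_big_seq => k kJI; rewrite C'E.
  + by rewrite (perm_uniq pm)/= iJI.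
  + by rewrite (perm_all _ pm)/= Qi.
  + by move=> k kJ; rewrite C'E ?mem_cat ?kJ//; apply: mCall; rewrite mem_cat kJ.
  + move=> k; rewrite inE => /orP[/eqP->|kI]; first by rewrite C'i.
    by rewrite C'E ?mem_cat ?kI ?orbT//; exact: rC.
- by apply: mC; rewrite mem_head.
Qed.

End Independence.

Section IndependentProducts.
Context {R : realType} {d : measure_display} {T : measurableType d}.
Variable P : probability T R.
Local Open Scope ereal_scope.

Lemma indep_integral_prod (U V : T -> R) :
    measurable_fun setT U -> measurable_fun setT V ->
    (forall x, 0 <= U x)%R -> (forall x, 0 <= V x)%R ->
    (forall A B, measurable A -> measurable B ->
      P (U @^-1` A `&` V @^-1` B) = P (U @^-1` A) * P (V @^-1` B)) ->
  \int[P]_x (U x * V x)%:E = \int[P]_x (U x)%:E * \int[P]_x (V x)%:E.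
Proof.
move=> mU mV U0 V0 UV.
pose Uf : {RV P >-> R} := HB.pack U (isMeasurableFun.Build _ _ _ _ _ mU).
pose Vf : {RV P >-> R} := HB.pack V (isMeasurableFun.Build _ _ _ _ _ mV).
have mUV : measurable_fun setT (fun x => (U x, V x)) by exact: measurable_fun_pair.
pose m1 := distribution P Uf; pose m2 := distribution P Vf.
pose m12 : {measure set (R * R) -> \bar R} := pushforward P (fun x => (U x, V x)).
have prodE : forall X, measurable X -> (m1 \x m2) X = m12 mUV X.
  apply: product_measure_unique => A B mA mB.
  by rewrite -UV.
(* [U] and [V] are non-negative, but the coordinates of the plane are not; absolute values make the
   integrand non-negative everywhere, as Tonelli requires. *)
have nE (W : T -> R) : (forall x, 0 <= W x)%R ->
    \int[P]_x (W x)%:E = \int[P]_x (`|W x|)%:E.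
  by move=> W0; apply: eq_integral => x _; rewrite ger0_norm.
pose nr : R -> R := fun x => `|x|%R.
pose pr : R * R -> R := fun z => (`|z.1| * `|z.2|)%R.
have mn : measurable_fun setT (EFin \o nr).
  apply/measurable_EFinP; exact: normr_measurable.
have mp : measurable_fun setT (EFin \o pr).
  apply/measurable_EFinP; apply: measurable_funM.
    exact: measurableT_comp (@normr_measurable R setT) measurable_fst.
  exact: measurableT_comp (@normr_measurable R setT) measurable_snd.
rewrite (nE (fun x => U x * V x)%R); last by move=> x; exact: mulr_ge0.
rewrite (nE U)// (nE V)//.
transitivity (\int[m12 mUV]_z (`|z.1| * `|z.2|)%:E).
  rewrite ge0_integral_pushforward//=.
  by rewrite preimage_setT; apply: eq_integral => x _; rewrite /= normrM.
rewrite (eq_measure_integral (m1 \x m2)%E); last by move=> A mA _; exact/esym/prodE.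
rewrite fubini_tonelli1//.
rewrite /fubini_F /=.
transitivity (\int[m1]_x (`|x|%:E * \int[m2]_y (`|y|)%:E)).
  apply: eq_integral => x _; under eq_integral do rewrite EFinM.
  by rewrite ge0_integralZl_EFin.
rewrite ge0_integralZr//; last by apply: integral_ge0 => y _; rewrite lee_fin.
by congr (_ * _); rewrite /m1 /m2 /distribution ge0_integral_pushforward.
Qed.

Variables (W : nat -> T -> R * R) (Q : pred nat).
Hypothesis mW : forall i, Q i -> measurable_fun setT (W i).
Hypothesis indepW : indep_on P W Q measurable.
Variable f : nat -> R * R -> R.
Hypothesis mf : forall i, measurable_fun setT (f i).
Hypothesis f0 : forall i z, (0 <= f i z)%R.

Let rho I x := (\prod_(i <- I) f i (W i x))%R.

Let mrho I : all Q I -> measurable_fun setT (rho I).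
Proof.
elim: I => [_|i I IH /= /andP[Qi QI]].
  by rewrite (_ : rho [::] = cst 1%R)//; apply/funext => x; rewrite /rho big_nil.
rewrite (_ : rho (i :: I) = (fun x => f i (W i x)) \* rho I)%R.
  apply: measurable_funM; last exact: IH.
  by apply: measurableT_comp; [exact: mf|exact: mW].
by apply/funext => x; rewrite /rho big_cons.
Qed.

Let rho_indep_cap I J C B : uniq (I ++ J) -> all Q (I ++ J) ->
    (forall i, i \in J -> measurable (C i)) -> measurable B ->
  P (rho I @^-1` B `&` cap W C J) = P (rho I @^-1` B) * P (cap W C J).
Proof.
elim: I J C B => [|i I IH] J C B /=.
  move=> uJ QJ mC mB; have [B1|B1] := pselect (B 1%R).
    rewrite (_ : rho [::] @^-1` B = setT); last first.
      by apply/seteqP; split=> x//= _; rewrite /rho big_nil.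
    by rewrite setTI probability_setT mul1e.
  rewrite (_ : rho [::] @^-1` B = set0); last first.
    by apply/seteqP; split=> x//=; rewrite /rho big_nil.
  by rewrite set0I measure0 mul0e.
move=> /andP[iIJ uIJ] /andP[Qi QIJ] mC mB.
have [QI QJ] : all Q I /\ all Q J by move: QIJ; rewrite all_cat => /andP.
have uJ : uniq J by move: uIJ; rewrite cat_uniq => /and3P[].
have [iI iJ] : i \notin I /\ i \notin J.
  by move: iIJ; rewrite mem_cat negb_or => /andP.
have mcap : measurable (cap W C J).
  by apply: measurable_cap => // k kJ; apply: mW; exact: (allP QJ).
pose X x := (f i (W i x), rho I x).
have mX : measurable_fun setT X.
  apply: measurable_fun_pair; last exact: mrho.
  by apply: measurableT_comp; [exact: mf|exact: mW].
pose D : set (R * R) := [set z | B (z.1 * z.2)%R].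
have mD : measurable D.
  rewrite -[D]setTI; have mm : measurable_fun setT (fun z : R * R => (z.1 * z.2)%R).
    by apply: measurable_funM; [exact: measurable_fst|exact: measurable_snd].
  exact: mm.
have -> : rho (i :: I) @^-1` B = X @^-1` D.
  by apply/seteqP; split=> x; rewrite /D /X/= /rho big_cons.
apply: (@indep_rectangle _ _ _ P X) => // _ [A [B' [mA mB' ->]]].
(* Used with [J' = [::]], which gives the probability of the rectangle alone, and with [J' = J]; the
   two differ exactly by the factor [P (cap W C J)]. *)
have key J' C' : uniq (i :: J') -> {in J', forall k, k \notin I} -> all Q J' ->
    (forall k, k \in J' -> measurable (C' k)) ->
  P (X @^-1` (A `*` B') `&` cap W C' J') =
  P (rho I @^-1` B') * (P (W i @^-1` (f i @^-1` A)) * P (cap W C' J')).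
  move=> uJ' IJ' QJ' mC'.
  pose C2 k := if k == i then f i @^-1` A else C' k.
  have C2i : C2 i = f i @^-1` A by rewrite /C2 eqxx.
  have C2E : {in J', C2 =1 C'}.
    move=> k kJ; rewrite /C2; case: eqP => // ki.
    by move: uJ' => /= /andP[]; rewrite -ki kJ.
  have mC2 k : k \in i :: J' -> measurable (C2 k).
    rewrite inE => /orP[/eqP ->|kJ]; last by rewrite C2E//; exact: mC'.
    by rewrite C2i -[X in measurable X]setTI; exact: mf.
  have -> : X @^-1` (A `*` B') `&` cap W C' J' =
            rho I @^-1` B' `&` cap W C2 (i :: J').
    rewrite cap_cons C2i (eq_cap _ C2E).
    by apply/seteqP; split=> x [] => [[]|] ? => [? ?|[]].
  rewrite IH//.
  - congr (_ * _); rewrite indepW//; last by rewrite /= Qi.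
    rewrite big_cons C2i indepW//; last by move: uJ' => /= /andP[].
    by congr (_ * _); apply: eq_big_seq => k kJ; rewrite C2E.
  - rewrite cat_uniq uJ' andbT; apply/andP; split.
      by move: uIJ; rewrite cat_uniq => /andP[].
    rewrite -all_predC; apply/allP => k; rewrite inE => /orP[/eqP->//|].
    exact: IJ'.
  - by rewrite all_cat QI /= Qi.
have := key [::] C; rewrite cap_nil setIT probability_setT mule1 => -> //.
rewrite key//; first by rewrite muleA.
- by rewrite /= iJ.
- move=> k kJ; apply/negP => kI.
  move: uIJ; rewrite cat_uniq => /and3P[_ /hasPn H _].
  by have := H _ kJ; rewrite /= kI.
Qed.

Lemma indep_integral_bigprod I : uniq I -> all Q I ->
  \int[P]_x (\prod_(i <- I) f i (W i x))%:E =
  \prod_(i <- I) \int[P]_x (f i (W i x))%:E.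
Proof.
elim: I => [|i I IH] /=.
  move=> _ _; under eq_integral do rewrite big_nil.
  by rewrite big_nil integral_cst// mul1e; exact: probability_setT.
move=> /andP[iI uI] /andP[Qi QI]; rewrite big_cons -IH//.
under eq_integral do rewrite big_cons.
apply: (@indep_integral_prod (fun x => f i (W i x)) (rho I)).
- by apply: measurableT_comp; [exact: mf|exact: mW].
- exact: mrho.
- by move=> x; exact: f0.
- by move=> x; apply: prodr_ge0 => k _; exact: f0.
- move=> A B mA mB.
  have := @rho_indep_cap I [:: i] (fun=> f i @^-1` A) B.
  rewrite cap_cons cap_nil setIT setIC muleC => -> //.
  + by rewrite cats1 rcons_uniq iI.
  + by rewrite all_cat QI /= Qi.
  + by move=> k _; rewrite -[X in measurable X]setTI; exact: mf.
Qed.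

End IndependentProducts.

(** * Concentration *)

Section ExponentialMoments.
Context {R : realType} {d : measure_display} {T : measurableType d}.
Variable P : probability T R.

(* For y <= 1/2 this is expR y <= (1 - y)^-1 = 1 + y + y ^ 2 / (1 - y), and for
   y > 1/2 the last term alone dominates since 4 * y ^ 2 > 1. *)
Lemma expR_le_quadratic (y : R) : expR y <= 1 + y + 4 * y ^+ 2 * expR `|y|.
Proof.
have e1 : 1 <= expR `|y|.
  by apply: le_trans (expR_ge1Dx _); rewrite lerDl.
have [y12|y12] := lerP y 2^-1; last first.
  have yp : 0 < y by lra.
  rewrite (ger0_norm (ltW yp)).
  have y0 : 0 < expR y by exact: expR_gt0.
  have : expR y <= 4 * y ^+ 2 * expR y.
    by rewrite ler_peMl// ?ltW//; nra.
  by move=> H; nra.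
have y1 : 0 < 1 - y by lra.
have H1 : expR y <= (1 - y)^-1.
  rewrite -[y in expR y]opprK expRN lef_pV2 ?posrE ?expR_gt0//.
  exact: expR_ge1Dx.
apply: (le_trans H1).
have -> : (1 - y)^-1 = 1 + y + y ^+ 2 * (1 - y)^-1 by field; rewrite gt_eqF.
rewrite lerD2l.
have H2 : (1 - y)^-1 <= 2.
  by rewrite invf_ple ?posrE//; lra.
have : y ^+ 2 * (1 - y)^-1 <= y ^+ 2 * 2 by rewrite ler_wpM2l ?sqr_ge0.
have : y ^+ 2 * 1 <= y ^+ 2 * expR `|y| by rewrite ler_wpM2l ?sqr_ge0.
have := sqr_ge0 y; lra.
Qed.

(** [expR |x|] is split into two halves: one dominates [expR |th * x|], the other absorbs the square
    through [x ^ 2 <= 16 * expR (|x| / 2)]. Hence 64 = 4 * 16. *)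
Lemma expR_scaled_le (th x : R) : `|th| <= 2^-1 ->
  expR (th * x) <= 1 + (th * x + 64 * th ^+ 2 * expR `|x|).
Proof.
move=> th12; apply: (le_trans (expR_le_quadratic _)).
rewrite -addrA lerD2l lerD2l exprMn.
have h1 : expR `|th * x| <= expR (`|x| / 2).
  by rewrite ler_expR normrM; have := normr_ge0 x; nra.
have h2 : x ^+ 2 <= 16 * expR (`|x| / 2).
  have -> : `|x| / 2 = `|x| / 4 + `|x| / 4 by field.
  rewrite expRD -[x ^+ 2]real_normK ?num_real//.
  have := expR_ge1Dx (`|x| / 4); have := normr_ge0 x.
  set e := expR _; nra.
have h3 : expR `|x| = expR (`|x| / 2) * expR (`|x| / 2).
  by rewrite -expRD; congr expR; field.
rewrite h3; set E := expR (`|x| / 2) in h1 h2 *.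
have E0 : 0 < E by exact: expR_gt0.
have t0 := sqr_ge0 th; have x0 := sqr_ge0 x.
have : x ^+ 2 * expR `|th * x| <= 16 * E * E.
  by apply: ler_pM => //; exact: expR_ge0.
move=> /(ler_wpM2l t0); lra.
Qed.

Lemma integrable_expR_norm (X : T -> R) : measurable_fun setT X ->
  (\int[P]_x (expR `|X x|)%:E <= 2%:E)%E -> P.-integrable setT (EFin \o X).
Proof.
move=> mX X2; have mE : measurable_fun setT (fun x => expR `|X x|).
  apply: measurableT_comp; first exact: measurable_expR.
  exact: measurableT_comp (@normr_measurable R setT) mX.
apply: (@le_integrable _ _ _ P setT measurableT _ (fun x => (expR `|X x|)%:E)).
- exact/measurable_EFinP.
- move=> x _ /=; rewrite lee_fin [leRHS]ger0_norm ?expR_ge0//.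
  by apply: le_trans (expR_ge1Dx _); rewrite lerDr.
- apply/integrableP; split; first exact/measurable_EFinP.
  under eq_integral => x _ do rewrite /= ger0_norm ?expR_ge0//.
  by apply: le_lt_trans X2 _; rewrite ltry.
Qed.

(** Integrating [expR_scaled_le] gives [1 + th * mu + 128 * th ^ 2], with 128 = 64 * 2; by
    [1 + y <= expR y], centring then cancels the linear term exactly. *)
Lemma centered_mgf_le (X : T -> R) (th : R) : measurable_fun setT X ->
    (\int[P]_x (expR `|X x|)%:E <= 2%:E)%E -> `|th| <= 2^-1 ->
  (\int[P]_x (expR (th * (X x - fine (\int[P]_x (X x)%:E))))%:E
     <= (expR (128 * th ^+ 2))%:E)%E.
Proof.
move=> mX X2 th12; have iX := integrable_expR_norm mX X2.
set mu := fine _.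
have muE : (\int[P]_x (X x)%:E = mu%:E)%E.
  by rewrite /mu fineK//; exact: integrable_fin_num.
have mE : measurable_fun setT (fun x => expR `|X x|).
  apply: measurableT_comp; first exact: measurable_expR.
  exact: measurableT_comp (@normr_measurable R setT) mX.
have mth : measurable_fun setT (fun x => expR (th * X x)).
  apply: measurableT_comp; first exact: measurable_expR.
  exact: measurable_funM.
have iE : P.-integrable setT (EFin \o (fun x => expR `|X x|)).
  apply/integrableP; split; first exact/measurable_EFinP.
  under eq_integral => x _ do rewrite /= ger0_norm ?expR_ge0//.
  by apply: le_lt_trans X2 _; rewrite ltry.
have step : (\int[P]_x (expR (th * X x))%:E <= (1 + (th * mu + 128 * th ^+ 2))%:E)%E.
  apply: (@le_trans _ _ (\int[P]_x ((1%R)%:E +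
      ((th%:E * (X x)%:E) + ((64 * th ^+ 2)%:E * (expR `|X x|)%:E))))%E).
    apply: ge0_le_integral => //.
    - exact/measurable_EFinP.
    - apply/measurable_EFinP; apply: measurable_funD => //.
      by apply: measurable_funD; apply: measurable_funM.
    - by move=> x _; rewrite -!EFinM -!EFinD lee_fin; exact: expR_scaled_le.
  have i1 : P.-integrable setT (fun x => th%:E * (X x)%:E)%E by exact: integrableZl.
  have i2 : P.-integrable setT (fun x => (64 * th ^+ 2)%:E * (expR `|X x|)%:E)%E.
    exact: integrableZl.
  rewrite integralD//; last 2 first.
  - exact: finite_measure_integrable_cst.
  - exact: integrableD.
  rewrite integralD// integral_cst// !integralZl// muE.
  rewrite [X in (X + _ <= _)%E](_ : _ = 1%:E); last first.
    by rewrite mul1e; exact: probability_setT.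
  rewrite EFinD leeD2l// EFinD -EFinM leeD2l//.
  apply: (@le_trans _ _ ((64 * th ^+ 2)%:E * 2%:E)%E).
    by apply: lee_wpmul2l => //; rewrite lee_fin mulr_ge0// sqr_ge0.
  by rewrite -EFinM lee_fin; lra.
have -> : (\int[P]_x (expR (th * (X x - mu)))%:E =
           (expR (- (th * mu)))%:E * \int[P]_x (expR (th * X x))%:E)%E.
  rewrite -ge0_integralZl_EFin ?expR_ge0//.
  - by apply: eq_integral => x _; rewrite -EFinM -expRD; congr (expR _)%:E; ring.
  - exact/measurable_EFinP.
apply: (@le_trans _ _ ((expR (- (th * mu)))%:E * (expR (th * mu + 128 * th ^+ 2))%:E)%E).
  apply: lee_wpmul2l; first by rewrite lee_fin expR_ge0.
  by apply: (le_trans step); rewrite lee_fin expR_ge1Dx.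
by rewrite -EFinM lee_fin -expRD addKr.
Qed.

Variables (W : nat -> T -> R * R) (Q : pred nat).
Hypothesis mW : forall i, Q i -> measurable_fun setT (W i).
Hypothesis indepW : indep_on P W Q measurable.

Lemma chernoff_indep (g : nat -> R * R -> R) (I : seq nat) (r c s : R) :
    (forall i, measurable_fun setT (g i)) -> uniq I -> all Q I -> 0 < r ->
    (forall i, i \in I -> (\int[P]_x (expR (r * g i (W i x)))%:E <= (expR c)%:E)%E) ->
  (P [set x | (s <= \sum_(i <- I) g i (W i x))%R]
     <= (expR ((size I)%:R * c - r * s))%:E)%E.
Proof.
move=> mg uI QI r0 gc.
pose S x := \sum_(i <- I) g i (W i x).
have mS : measurable_fun setT S.
  rewrite /S; elim: I uI QI {gc S} => [|i I IH] /= .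
    by move=> _ _; under eq_fun do rewrite big_nil; exact: measurable_cst.
  move=> /andP[_ uI] /andP[Qi QI]; under eq_fun do rewrite big_cons.
  apply: measurable_funD; last exact: IH.
  by apply: measurableT_comp; [exact: mg|exact: mW].
pose Sf : {RV P >-> R} := HB.pack S (isMeasurableFun.Build _ _ _ _ _ mS).
have := @chernoff _ _ _ P Sf r s r0.
move/le_trans; apply.
have -> : ('M_P Sf r = \prod_(i <- I) \int[P]_x (expR (r * g i (W i x)))%:E)%E.
  rewrite -(@indep_integral_bigprod _ _ _ P W Q mW indepW
     (fun i z => expR (r * g i z)))//.
  - rewrite /mmt_gen_fun unlock; apply: eq_integral => x _ /=.
    by rewrite -expR_sum mulrC mulr_sumr.
  - move=> i; apply: measurableT_comp; first exact: measurable_expR.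
    exact: measurable_funM.
apply: (@le_trans _ _ ((expR ((size I)%:R * c))%:E * (expR (- (r * s)))%:E)%E).
  apply: lee_wpmul2r; first by rewrite lee_fin expR_ge0.
  elim: I gc {uI QI S mS Sf} => [|i I IH] gc.
    by rewrite big_nil mul0r expR0.
  rewrite big_cons /= -natr1 mulrDl mul1r addrC expRD EFinM.
  apply: lee_pmul.
  - by apply: integral_ge0 => x _; rewrite lee_fin expR_ge0.
  - by apply: prode_ge0 => k _; apply: integral_ge0 => x _; rewrite lee_fin expR_ge0.
  - by apply: gc; rewrite mem_head.
  - by apply: IH => k kI; apply: gc; rewrite inE kI orbT.
by rewrite -EFinM -expRD.
Qed.

End ExponentialMoments.

(** * Pairs of coordinates and their exponential moments *)

Section CoordinatePairs.
Context {R : realType} {d : measure_display} {T : measurableType d}.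
Variables (P : probability T R) (p : nat) (Y : nat -> 'I_p -> T -> R).
Hypothesis regY : regular P Y.

(** Every statistic is built from products of two coordinates, so a pair carries all the information
    needed and stays in a space generated by rectangles. *)
Definition coords (j k : 'I_p) (i : nat) (x : T) : R * R := (Y i j x, Y i k x).

Lemma measurable_coord i j : (0 < i)%N -> measurable_fun setT (Y i j).
Proof. by move=> i0; have [] := regY i0 j. Qed.

Lemma measurable_coords j k i : (0 < i)%N -> measurable_fun setT (coords j k i).
Proof. by move=> i0; apply: measurable_fun_pair; exact: measurable_coord. Qed.

(** The intersection on the right covers [j = k], where both constraints fall on the same coordinate
    of the cylinder. *)
Lemma coords_rectangleE j k i (A B : set R) :
  coords j k i @^-1` (A `*` B) =
  [set x | forall l : 'I_p, ((if l == j then A else setT) `&`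
                             (if l == k then B else setT)) (Y i l x)].
Proof.
apply/seteqP; split => x /=.
  by move=> [Aj Bk] l; split; case: eqP => // ->.
move=> H; split.
  by have := H j; rewrite eqxx => -[].
by have := H k; rewrite eqxx => -[].
Qed.

Lemma indep_coords j k : indep_vectors P Y ->
  indep_on P (coords j k) (fun i => 0 < i)%N measurable.
Proof.
move=> indY; apply: indep_on_measurable; first by move=> i; exact: measurable_coords.
move=> C I uI I0 rC.
(* [indep_vectors] asks for measurable cylinders at every index, so indices outside [I] receive
   [setT]. *)
have /choice[AB ABP] : forall i, exists AB : set R * set R,
    [/\ measurable AB.1, measurable AB.2 & i \in I -> C i = AB.1 `*` AB.2].
  move=> i; have [iI|iI] := boolP (i \in I); last first.
    by exists (setT, setT); split => //=.
  by have [A [B [mA mB ->]]] := rC i iI; exists (A, B); split.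
pose D i l := (if l == j then (AB i).1 else setT) `&`
              (if l == k then (AB i).2 else setT).
have capE : cap (coords j k) C I =
    [set x | forall i, i \in I -> forall l, D i l (Y i l x)].
  apply/seteqP; split => x H i iI; have [_ _ /(_ iI) CE] := ABP i.
    have : (coords j k i @^-1` ((AB i).1 `*` (AB i).2)) x by rewrite -CE; exact: H.
    by rewrite coords_rectangleE.
  suff : (coords j k i @^-1` ((AB i).1 `*` (AB i).2)) x by rewrite -CE.
  by rewrite coords_rectangleE; exact: H.
rewrite capE indY//.
- apply: eq_big_seq => i iI; have [_ _ /(_ iI) ->] := ABP i.
  by rewrite coords_rectangleE.
- by move=> i l; have [mA mB _] := ABP i; apply: measurableI; case: ifP.
Qed.

Lemma integrable_coordM i j k : (0 < i)%N ->
  P.-integrable setT (EFin \o (fun x => Y i j x * Y i k x)).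
Proof.
move=> i0; have [mj ij] := regY i0 j; have [mk ik] := regY i0 k.
apply: (@le_integrable _ _ _ P setT measurableT _
  (fun x => (Y i j x ^+ 2)%:E + (Y i k x ^+ 2)%:E)%E).
- by apply/measurable_EFinP; exact: measurable_funM.
- move=> x _ /=; rewrite lee_fin [leRHS]ger0_norm ?addr_ge0 ?sqr_ge0// normrM.
  rewrite -[Y i j x ^+ 2]real_normK ?num_real// -[Y i k x ^+ 2]real_normK ?num_real//.
  set a := `|_|; set b := `|_|; have : 0 <= (a - b) ^+ 2 by exact: sqr_ge0.
  have a0 : 0 <= a by exact: normr_ge0. have b0 : 0 <= b by exact: normr_ge0.
  nra.
- exact: integrableD.
Qed.

Lemma same_law_Sigma i i' : (0 < i)%N -> (0 < i')%N -> same_law P Y i i' ->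
  Sigma P Y i = Sigma P Y i'.
Proof.
move=> i0 i'0 ii'; apply/matrixP => j k; rewrite !mxE /E2; congr fine.
pose f (z : R * R) : \bar R := (z.1 * z.2)%:E.
have mf : measurable_fun setT f.
  by apply/measurable_EFinP; apply: measurable_funM;
    [exact: measurable_fst|exact: measurable_snd].
have mi := measurable_coords j k i0; have mi' := measurable_coords j k i'0.
pose m1 : {measure set (R * R) -> \bar R} := pushforward P (coords j k i).
pose m2 : {measure set (R * R) -> \bar R} := pushforward P (coords j k i').
have m12 : forall C, measurable C -> m1 mi C = m2 mi' C.
  apply: measure_eq_rectangle.
    change (P (coords j k i @^-1` setT) < +oo)%E.
    by rewrite preimage_setT probability_setT ltry.
  move=> _ [A [B [mA mB ->]]].
  change (P (coords j k i @^-1` (A `*` B)) = P (coords j k i' @^-1` (A `*` B))).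
  rewrite !coords_rectangleE.
  apply: (ii' (fun l => (if l == j then A else setT) `&` (if l == k then B else setT))).
  by move=> l; apply: measurableI; case: ifP.
transitivity (\int[m1 mi]_z f z)%E.
  by rewrite integral_pushforward// preimage_setT; exact: integrable_coordM.
rewrite (eq_measure_integral (m2 mi')); last by move=> A mA _; exact: m12.
by rewrite integral_pushforward// preimage_setT; exact: integrable_coordM.
Qed.

Lemma delta_unit_sphere (j : 'I_p) : delta_mx j 0 \in (unit_sphere : set 'cV[R]_p).
Proof.
rewrite inE /unit_sphere /= (bigD1 j)//= big1 => [|l lj].
  by rewrite mxE !eqxx expr1n addr0.
by rewrite mxE (negbTE lj) expr0n.
Qed.

Lemma proj_delta i (j : 'I_p) : Defs.proj Y i (delta_mx j 0) = Y i j.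
Proof.
apply/funext => x; rewrite /Defs.proj (bigD1 j)//= big1 => [|l lj].
  by rewrite mxE !eqxx mul1r addr0.
by rewrite mxE (negbTE lj) mul0r.
Qed.

Lemma Sigma_diagE i j : (0 < i)%N ->
  (\int[P]_x (Y i j x ^+ 2)%:E)%E = (Sigma P Y i j j)%:E.
Proof.
move=> i0; rewrite mxE /E2 fineK//.
by apply: integrable_fin_num => //; exact: integrable_coordM.
Qed.

(** The factor 2 makes the bound on [psi2] strict: some admissible radius lies below the square root
    of [2 * u * s], whether or not the infimum is attained. [K] is left free so that one scale can
    serve all coordinates. *)
Lemma condC_expR_sqr u K i j : condC P Y u -> (0 < i)%N -> 0 < u ->
    0 < Sigma P Y i j j -> 2 * u * Sigma P Y i j j <= K ->
  (\int[P]_x (expR (Y i j x ^+ 2 / K))%:E <= 2%:E)%E.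
Proof.
move=> cC i0 u0 s0 sK; have := cC i i0 _ (delta_unit_sphere j).
rewrite proj_delta Sigma_diagE//; set s := Sigma _ _ _ _ _ in s0 sK *.
move=> psile; pose q := Num.sqrt (2 * u * s).
have us0 : 0 < 2 * u * s by rewrite !mulr_gt0.
have q0 : 0 < q by rewrite sqrtr_gt0.
have q2 : q ^+ 2 = 2 * u * s by rewrite sqr_sqrtr// ltW.
have : (psi2 P (Y i j) < q%:E)%E.
  rewrite ltNge; apply/negP => qpsi.
  have : (q%:E * q%:E <= u%:E * s%:E)%E.
    by apply: le_trans psile; apply: lee_pmul => //; rewrite lee_fin ltW.
  rewrite -!EFinM lee_fin -expr2 q2; nra.
move=> /ereal_inf_lt[_ [r [r0 rP] <-]]; rewrite lte_fin => rq.
apply: le_trans rP.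
have mY := measurable_coord j i0.
apply: ge0_le_integral => //.
- apply/measurable_EFinP; apply: measurableT_comp; first exact: measurable_expR.
  by apply: measurable_funM => //; exact: measurable_funX.
- apply/measurable_EFinP; apply: measurableT_comp; first exact: measurable_expR.
  by apply: measurable_funM => //; exact: measurable_funX.
- move=> x _; rewrite lee_fin ler_expR ler_wpM2l ?sqr_ge0//.
  rewrite lef_pV2 ?posrE ?exprn_gt0//; last by rewrite (lt_le_trans us0).
  by apply: le_trans sK; rewrite -q2 ler_pXn2r ?nnegrE// ltW.
Qed.

(** [|ab| <= (a^2 + b^2) / 2], then the arithmetic-geometric mean of the two exponentials: the bound
    2 passes from squares to products without loss. *)
Lemma expR_coordM_le2 K i j k : 0 < K -> (0 < i)%N ->
    (forall l, (\int[P]_x (expR (Y i l x ^+ 2 / K))%:E <= 2%:E)%E) ->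
  (\int[P]_x (expR `|Y i j x * Y i k x / K|)%:E <= 2%:E)%E.
Proof.
move=> K0 i0 YK.
have mY l := measurable_coord l i0.
have mE l : measurable_fun setT (fun x => expR (Y i l x ^+ 2 / K)).
  apply: measurableT_comp; first exact: measurable_expR.
  by apply: measurable_funM => //; exact: measurable_funX.
apply: (@le_trans _ _ (\int[P]_x ((2^-1)%:E * (expR (Y i j x ^+ 2 / K))%:E +
    (2^-1)%:E * (expR (Y i k x ^+ 2 / K))%:E))%E).
  apply: ge0_le_integral => //.
  - apply/measurable_EFinP; apply: measurableT_comp; first exact: measurable_expR.
    apply: measurableT_comp (@normr_measurable R setT) _.
    by apply: measurable_funM => //; exact: measurable_funM.
  - by apply/measurable_EFinP; apply: measurable_funD; exact: measurable_funM.
  - move=> x _; rewrite -!EFinM -EFinD lee_fin.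
    set a := Y i j x; set b := Y i k x.
    have e2 c : expR (c ^+ 2 / K) = expR (c ^+ 2 / (2 * K)) ^+ 2.
      by rewrite [RHS]expr2 -expRD; congr expR; field; rewrite gt_eqF.
    have h : expR `|a * b / K| <= expR (a ^+ 2 / (2 * K)) * expR (b ^+ 2 / (2 * K)).
      have KV : 0 <= K^-1 by rewrite invr_ge0 ltW.
      rewrite -expRD ler_expR !normrM (ger0_norm KV).
      rewrite -[a ^+ 2]real_normK ?num_real// -[b ^+ 2]real_normK ?num_real//.
      set A := `|a|; set B := `|b|.
      have -> : A ^+ 2 / (2 * K) + B ^+ 2 / (2 * K) = (A ^+ 2 + B ^+ 2) / 2 / K.
        by field; rewrite gt_eqF.
      apply: ler_wpM2r => //.
      by have := sqr_ge0 (A - B); nra.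
    apply: (le_trans h); rewrite !e2.
    set A := expR _; set B := expR _.
    by have := sqr_ge0 (A - B); nra.
rewrite ge0_integralD//; last 2 first.
- by apply/measurable_EFinP; exact: measurable_funM.
- by apply/measurable_EFinP; exact: measurable_funM.
rewrite !ge0_integralZl_EFin ?invr_ge0//; last 2 first.
- exact/measurable_EFinP.
- exact/measurable_EFinP.
apply: (@le_trans _ _ ((2^-1)%:E * 2%:E + (2^-1)%:E * 2%:E)%E).
  by apply: leeD; apply: lee_wpmul2l => //; rewrite lee_fin invr_ge0.
by rewrite -!EFinM -EFinD lee_fin; lra.
Qed.

End CoordinatePairs.

Definition sample_moment {R : realType} {T : Type} {p : nat}
    (Y : nat -> 'I_p -> T -> R) (I : seq nat) (j k : 'I_p) (x : T) : R :=
  (size I)%:R^-1 * \sum_(i <- I) Y i j x * Y i k x.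

Definition rate {R : realType} (L m : R) : R :=
  Num.max (Num.sqrt (L / m)) (L / m).

Section Deviations.
Context {R : realType} {d : measure_display} {T : measurableType d}.

Lemma measurable_ge (f : T -> R) e : measurable_fun setT f ->
  measurable [set x | e <= f x].
Proof.
move=> mf; rewrite (_ : [set x | e <= f x] = f @^-1` `[e, +oo[%classic).
  by rewrite -[X in measurable X]setTI; apply: mf => //; exact: measurable_itv.
by apply/seteqP; split => x /=; rewrite in_itv/= andbT.
Qed.

Lemma measurable_gt (f : T -> R) e : measurable_fun setT f ->
  measurable [set x | e < f x].
Proof.
move=> mf; rewrite (_ : [set x | e < f x] = f @^-1` `]e, +oo[%classic).
  by rewrite -[X in measurable X]setTI; apply: mf => //; exact: measurable_itv.
by apply/seteqP; split => x /=; rewrite in_itv/= andbT.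
Qed.

Variables (P : probability T R) (p : nat) (Y : nat -> 'I_p -> T -> R).
Hypothesis regY : regular P Y.
Hypothesis indY : indep_vectors P Y.

Lemma measurable_sample_moment I j k : all (fun i => 0 < i)%N I ->
  measurable_fun setT (sample_moment Y I j k).
Proof.
move=> I0; apply: measurable_funM => //.
elim: I I0 => [|i I IH] /=.
  by move=> _; under eq_fun do rewrite big_nil; exact: measurable_cst.
move=> /andP[i0 I0]; under eq_fun do rewrite big_cons.
apply: measurable_funD; last exact: IH.
by apply: measurable_funM; exact: (measurable_coord regY).
Qed.

Definition deviation (I : seq nat) j k (mu e : R) : set T :=
  [set x | e <= `|sample_moment Y I j k x - mu|].

Lemma measurable_deviation I j k mu e : all (fun i => 0 < i)%N I ->
  measurable (deviation I j k mu e).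
Proof.
move=> I0; apply: measurable_ge; apply: measurableT_comp (@normr_measurable R setT) _.
by apply: measurable_funB => //; exact: measurable_sample_moment.
Qed.

(* The optimal exponent is min(sqrt(L/m), 1) / 2: the sub-Gaussian regime
   L <= m and the sub-exponential one L >= m give the same bound. *)
Lemma bernstein_exponent (L m a : R) : 0 < L -> 0 < m -> 0 <= a ->
  exists th, [/\ 0 < th, th <= 2^-1 &
    m * (128 * th ^+ 2) - th * (m * (a * rate L m)) <= - (a / 2 - 32) * L].
Proof.
move=> L0 m0 a0.
pose l := L / m; have l0 : 0 < l by rewrite divr_gt0.
have mL : m * l = L by rewrite /l mulrCA divff ?mulr1// gt_eqF.
rewrite /rate -/l; have [l1|l1] := leP l 1.
  have sl : 0 < Num.sqrt l by rewrite sqrtr_gt0.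
  have sq : Num.sqrt l ^+ 2 = l by rewrite sqr_sqrtr// ltW.
  have sl1 : Num.sqrt l <= 1 by rewrite -sqrtr1 ler_wsqrtr.
  have -> : Num.max (Num.sqrt l) l = Num.sqrt l.
    by apply/max_idPl; rewrite -[leLHS]sq expr2 ler_piMl// ltW.
  exists (Num.sqrt l / 2); split; [by rewrite divr_gt0|lra|].
  have -> : m * (128 * (Num.sqrt l / 2) ^+ 2) - Num.sqrt l / 2 * (m * (a * Num.sqrt l))
     = 32 * (m * Num.sqrt l ^+ 2) - a / 2 * (m * Num.sqrt l ^+ 2) by field.
  rewrite sq mL; lra.
have -> : Num.max (Num.sqrt l) l = l.
  have sl1 : 1 <= Num.sqrt l by rewrite -sqrtr1 ler_wsqrtr// ltW.
  have sq : Num.sqrt l ^+ 2 = l by rewrite sqr_sqrtr// ltW.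
  by apply/max_idPr; nra.
exists 2^-1; split => //.
have -> : m * (128 * 2^-1 ^+ 2) - 2^-1 * (m * (a * l)) = 32 * m - a / 2 * (m * l) by field.
rewrite mL; have : m <= L by rewrite -mL; nra.
lra.
Qed.

Lemma deviation_le I j k K mu a L : uniq I -> all (fun i => 0 < i)%N I ->
    (0 < size I)%N -> 0 < K -> 0 < L -> 0 <= a ->
    (forall i, i \in I -> Sigma P Y i j k = mu) ->
    (forall i l, i \in I -> (\int[P]_x (expR (Y i l x ^+ 2 / K))%:E <= 2%:E)%E) ->
  (P (deviation I j k mu (K * (a * rate L (size I)%:R)))
    <= (2 * expR (- (a / 2 - 32) * L))%:E)%E.
Proof.
move=> uI I0 szI K0 L0 a0 muI YK.
set m := (size I)%:R; have m0 : 0 < m by rewrite ltr0n.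
have [th [th0 th12 thE]] := bernstein_exponent L0 m0 a0.
(* The sign [e], equal to 1 or -1, selects the tail; division by [K] normalises the product to
   exponential moment at most 2. *)
pose g (e : R) (i : nat) (z : R * R) := e * (z.1 * z.2 / K - mu / K).
pose A e : set T := [set x | m * (a * rate L m) <= \sum_(i <- I) g e i (coords Y j k i x)].
have mcY i : (0 < i)%N -> measurable_fun setT (coords Y j k i).
  exact: (measurable_coords regY).
have mg e i : measurable_fun setT (g e i).
  apply: measurable_funM => //; apply: measurable_funB => //; apply: measurable_funM => //.
  by apply: measurable_funM; [exact: measurable_fst|exact: measurable_snd].
have PA e : `|e| = 1 -> (P (A e) <= (expR (- (a / 2 - 32) * L))%:E)%E.
  move=> e1.
  apply: (@le_trans _ _ (expR (m * (128 * th ^+ 2) - th * (m * (a * rate L m))))%:E); last first.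
    by rewrite lee_fin ler_expR.
  apply: (@chernoff_indep _ _ _ P (coords Y j k) _ mcY (indep_coords regY j k indY) (g e)) => //.
  move=> i iI; have i0 : (0 < i)%N := allP I0 i iI.
  pose X x := Y i j x * Y i k x / K.
  have mX : measurable_fun setT X.
    apply: measurable_funM => //.
    by apply: measurable_funM; exact: (measurable_coord regY).
  have X2 : (\int[P]_x (expR `|X x|)%:E <= 2%:E)%E.
    by apply: expR_coordM_le2 => // l; exact: YK.
  have muX : fine (\int[P]_x (X x)%:E) = mu / K.
    rewrite -(muI i iI) mxE /E2 mulrC -[in RHS](@fineK _ (\int[P]_x (Y i j x * Y i k x)%:E)%E); last first.
      by apply: integrable_fin_num => //; exact: integrable_coordM.
    rewrite /= -[K^-1]/(fine (K^-1)%:E) -fineM//; last first.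
      by apply: integrable_fin_num => //; exact: integrable_coordM.
    rewrite -integralZl//; last exact: integrable_coordM.
    by congr fine; apply: eq_integral => x _; rewrite -EFinM mulrC.
  have := @centered_mgf_le _ _ _ P X (th * e) mX X2.
  rewrite muX normrM e1 mulr1 gtr0_norm// => /(_ th12).
  have -> : (th * e) ^+ 2 = th ^+ 2.
    by rewrite exprMn -[e ^+ 2]real_normK ?num_real// e1 expr1n mulr1.
  apply: le_trans; rewrite le_eqVlt; apply/orP; left; apply/eqP.
  by apply: eq_integral => x _; rewrite /g /= mulrA.
have mA e : measurable (A e).
  apply: measurable_ge; elim: I I0 {A PA szI uI muI YK m m0 thE} => [|i I IH] /=.
    by move=> _; under eq_fun do rewrite big_nil; exact: measurable_cst.
  move=> /andP[i0 I0]; under eq_fun do rewrite big_cons.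
  apply: measurable_funD; last exact: IH.
  by apply: measurableT_comp; [exact: mg|exact: mcY].
apply: (@le_trans _ _ (P (A 1 `|` A (-1)))).
  apply: le_measure; rewrite ?inE; [exact: measurable_deviation|exact: measurableU|].
  move=> x; rewrite /deviation /=.
  have sumE e : \sum_(i <- I) g e i (coords Y j k i x) =
      m * (e * (sample_moment Y I j k x - mu)) / K.
    rewrite /g -mulr_sumr sumrB big_const_seq count_predT iter_addr addr0 -mulr_suml.
    rewrite /sample_moment -/m -[in LHS](mulr_natl (mu / K)) -/m /=.
    by field; rewrite !gt_eqF.
  rewrite ler_normr => /orP[H|H]; [left|right]; rewrite /A /= sumE.
    by rewrite -mulrA ler_pM2l// mul1r ler_pdivlMr// mulrC.
  by rewrite -mulrA ler_pM2l// mulN1r ler_pdivlMr// mulrC.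
apply: (@le_trans _ _ (P (A 1%R) + P (A (-1)%R))%E); first exact: measureU2.
by rewrite mulr2n mulrDl mul1r EFinD; apply: leeD; apply: PA; rewrite ?normrN normr1.
Qed.

End Deviations.

(** * Anti-concentration of empirical variances *)

Section LowerTail.
Context {R : realType}.

Lemma density_small_ball d (T : measurableType d) (P : probability T R)
    (X : T -> R) (w a : R) : cont_density_bounded P X w -> 0 <= a ->
  (P (X @^-1` `[(- a)%R, a]%classic) <= (2 * a * w)%:E)%E.
Proof.
move=> [f [cf [fw XP]]] a0; rewrite XP; last exact: measurable_itv.
have mf : measurable_fun setT f by exact: continuous_measurable_fun.
apply: (@le_trans _ _ (\int[lebesgue_measure]_(y in `[(- a)%R, a]%classic) (w%:E))%E).
  apply: ge0_le_integral => //.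
  - by move=> y _; rewrite lee_fin; have /andP[] := fw y.
  - by apply/measurable_EFinP; exact: measurable_funTS.
  - by move=> y _; rewrite lee_fin; have /andP[] := fw y.
rewrite integral_cst//= lebesgue_measure_itv/= lte_fin.
case: ifPn => [_|_]; last by rewrite mule0 lee_fin; have /andP[] := fw 0; nra.
by rewrite -EFinD -EFinM lee_fin; lra.
Qed.

(* Split according to whether |X| <= a: a small ball has probability at most
   2 a w, and outside it the exponential is at most expR (- th * a ^ 2). *)
Lemma sqr_laplace_small (w q : R) : 0 < w -> 0 < q < 1 -> exists th, 0 < th /\
  forall d (T : measurableType d) (P : probability T R) (X : T -> R),
    measurable_fun setT X -> cont_density_bounded P X w ->
    (\int[P]_x (expR (th * - (X x ^+ 2)))%:E <= q%:E)%E.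
Proof.
move=> w0 /andP[q0 q1].
(* The two parts of the split are both made equal to [q / 2]: [2 * a * w = q / 2] and
   [expR (- th * a ^ 2) = q / 2]. *)
pose a := q / (4 * w); have a0 : 0 < a by rewrite divr_gt0// mulr_gt0.
pose th := - ln (q / 2) / a ^+ 2.
have th0 : 0 < th.
  by rewrite divr_gt0 ?exprn_gt0// oppr_gt0 ln_lt0//; apply/andP; split; lra.
exists th; split => // d T P X mX cX.
pose B := X @^-1` `[(- a)%R, a]%classic.
have mB : measurable B.
  by rewrite -[B]setTI; apply: mX => //; exact: measurable_itv.
apply: (@le_trans _ _ (\int[P]_x ((\1_B x)%:E + (q / 2)%:E))%E).
  apply: ge0_le_integral => //.
  - apply/measurable_EFinP; apply: measurableT_comp; first exact: measurable_expR.
    by apply: measurable_funM => //; apply: measurableT_comp => //; exact: measurable_funX.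
  - by apply/measurable_EFinP; apply: measurable_funD => //; exact: measurable_indic.
  - move=> x _; rewrite -EFinD lee_fin indicE; have [xB|xB] := boolP (x \in B).
      rewrite (@le_trans _ _ 1)//; last by rewrite lerDl; lra.
      by rewrite -expR0 ler_expR mulrN oppr_le0 mulr_ge0 ?sqr_ge0// ltW.
    rewrite add0r -[leRHS]lnK ?posrE; last by lra.
    rewrite ler_expR mulrN -[leRHS]opprK lerN2 -[leLHS]divr1 /th.
    have aX : a ^+ 2 <= X x ^+ 2.
      rewrite -[X x ^+ 2]real_normK ?num_real// ler_pXn2r ?nnegrE ?(ltW a0)//.
      rewrite leNgt; apply: contra xB => /ltW; rewrite ler_norml => H.
      by rewrite inE /B /= in_itv.
    have lq : 0 <= - ln (q / 2).
      by rewrite oppr_ge0 ltW// ln_lt0//; apply/andP; split; lra.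
    by rewrite divr1 -mulrA ler_peMr// mulrC ler_pdivlMr ?exprn_gt0// mul1r.
rewrite ge0_integralD//; last 2 first.
- exact/measurable_EFinP/measurable_indic.
- by move=> x _; rewrite lee_fin divr_ge0// ltW.
rewrite integral_indic// setIT integral_cst//.
rewrite [X in (_ + X <= _)%E](_ : _ = (q / 2)%:E); last first.
  by rewrite [X in (_ * X)%E](_ : _ = 1%E) ?mule1//; exact: probability_setT.
apply: (@le_trans _ _ ((2 * a * w)%:E + (q / 2)%:E)%E).
  by apply: leeD => //; apply: density_small_ball => //; exact: ltW.
rewrite -EFinD lee_fin /a le_eqVlt; apply/orP; left; apply/eqP.
by field; rewrite gt_eqF.
Qed.

(** Quantified over all probability spaces, dimensions and vectors, so that [c] is chosen from [w]
    and [q] alone, before any of them is given. *)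
Definition lower_tail (w q c : R) : Prop :=
  forall d (T : measurableType d) (P : probability T R) p
    (Y : nat -> 'I_p -> T -> R) (I : seq nat) j s2,
  regular P Y -> indep_vectors P Y -> condB P Y w ->
  uniq I -> all (fun i => 0 < i)%N I -> (0 < size I)%N -> 0 < s2 ->
  (forall i, i \in I -> Sigma P Y i j j = s2) ->
  (P [set x | (sample_moment Y I j j x <= c * s2)%R] <= (q ^+ size I)%:E)%E.

Lemma second_moment_lower_tail (w q : R) : 0 < w -> 0 < q < 1 ->
  exists c, 0 < c /\ lower_tail w q c.
Proof.
move=> w0 /andP[q0 q1].
(* This is [q / e]: at the level [th^-1] the exponential inequality costs a factor e per
   observation, which leaves [q] per observation. *)
pose q' := expR (ln q - 1).
have q'q : q' < q by rewrite -[ltRHS]lnK ?posrE// ltr_expR; lra.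
have [|th [th0 H]] := @sqr_laplace_small w q' w0.
  by rewrite expR_gt0/=; exact: lt_trans q1.
exists th^-1; split; first by rewrite invr_gt0.
move=> d T P p Y I j s2 regY indY cB uI I0 szI s20 s2I.
pose m : R := (size I)%:R; have m0 : 0 < m by rewrite ltr0n.
have mcY i : (0 < i)%N -> measurable_fun setT (coords Y j j i).
  exact: (measurable_coords regY).
pose g (i : nat) (z : R * R) : R := - (z.1 * z.2 / s2).
have := @chernoff_indep _ _ _ P (coords Y j j) _ mcY (indep_coords regY j j indY) g
  I th (ln q - 1) (- (m / th)).
have -> : [set x | - (m / th) <= \sum_(i <- I) g i (coords Y j j i x)] =
          [set x | sample_moment Y I j j x <= th^-1 * s2].
  apply: eq_set => x; rewrite /g sumrN lerN2 -mulr_suml /sample_moment -/m.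
  by rewrite ler_pdivrMr// ler_pdivrMl// mulrA.
have -> : m * (ln q - 1) - th * - (m / th) = m * ln q.
  by field; rewrite gt_eqF.
rewrite expRM_natl lnK ?posrE//; apply => //.
- move=> i; apply: measurableT_comp => //; apply: measurable_funM => //.
  by apply: measurable_funM; [exact: measurable_fst|exact: measurable_snd].
- move=> i iI; have i0 : (0 < i)%N := allP I0 i iI.
  have := cB i i0 _ (delta_unit_sphere j).
  rewrite proj_delta (_ : E2 P (Y i j) (Y i j) = s2); last first.
    by rewrite -(s2I i iI) mxE.
  have mX : measurable_fun setT (fun x => Y i j x / Num.sqrt s2).
    by apply: measurable_funM => //; exact: (measurable_coord regY).
  move=> /(H _ _ P _ mX); apply: le_trans; rewrite le_eqVlt; apply/orP; left; apply/eqP.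
  apply: eq_integral => x _; rewrite /g /= exprMn exprVn sqr_sqrtr ?ltW//.
Qed.

End LowerTail.

(** * Sparse eigenvalues *)

Section SparseEigenvalues.
Context {R : realType} {p : nat}.
Implicit Types (A B Z : 'M[R]_p) (v : 'cV[R]_p).

Definition outer v : 'M[R]_p := v *m v^T.

Lemma outerE v i j : outer v i j = v i 0 * v j 0.
Proof. by rewrite /outer mxE big_ord1 mxE. Qed.

Lemma qform_outer A v : qform A v = \tr (A *m outer v).
Proof. by rewrite /qform /outer mulmxA mxtrace_mulC mulmxA trace_mx11. Qed.

Lemma psd_outer v : psd (outer v).
Proof.
split; first by rewrite /outer trmx_mul trmxK.
move=> x; rewrite /qform /outer mulmxA -mulmxA mxE big_ord1.
rewrite (_ : (x^T *m v) 0 0 = (v^T *m x) 0 0) -?expr2 ?sqr_ge0//.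
by rewrite -[x^T *m v]trmxK trmx_mul trmxK mxE.
Qed.

(* Cauchy-Schwarz, read off from the nonnegativity of the sum of
   (|v_i| - c) ^ 2 over the support of v, with c the mean of the |v_i|. *)
Lemma sparse_l1_sqr_le (s : nat) v : v \in (sparse_sphere s) ->
  (\sum_i `|v i 0|) ^+ 2 <= s%:R.
Proof.
rewrite inE => -[/set_mem v1 vs].
pose S := finset (fun i => v i 0 != 0).
have {}vs : (#|S| <= s)%N.
  by apply: leq_trans vs; apply/eq_leq/eq_card => i; rewrite finset.in_set; apply/idP/idP; rewrite inE.
pose t := (#|S|)%:R : R.
have sumS : \sum_i `|v i 0| = \sum_(i in S) `|v i 0|.
  rewrite [RHS]big_mkcond; apply: eq_bigr => i _; rewrite inE.
  by case: eqP => [->|]; rewrite ?normr0.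
have sqS : \sum_(i in S) `|v i 0| ^+ 2 = 1.
  rewrite -[RHS]v1 [LHS]big_mkcond; apply: eq_bigr => i _; rewrite inE.
  by case: eqP => [->|]; rewrite ?expr0n// real_normK ?num_real.
apply: (@le_trans _ _ t); last by rewrite ler_nat.
set N := \sum_i _ in sumS *.
have H (c : R) : 0 <= \sum_(i in S) (`|v i 0| - c) ^+ 2.
  by apply: sumr_ge0 => i _; exact: sqr_ge0.
have E (c : R) : \sum_(i in S) (`|v i 0| - c) ^+ 2 = 1 - 2 * c * N + t * c ^+ 2.
  transitivity (\sum_(i in S) (`|v i 0| ^+ 2 - 2 * c * `|v i 0| + c ^+ 2)).
    by apply: eq_bigr => i _; ring.
  by rewrite big_split/= sumrB sqS -mulr_sumr -sumS sumr_const -(mulr_natl (c ^+ 2)).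
have t0 : 0 < t.
  rewrite ltr0n card_gt0; apply/negP => /eqP S0.
  by move: sqS; rewrite S0 big_set0 => /eqP; rewrite eq_sym oner_eq0.
have := H (N / t); rewrite E.
have -> : 1 - 2 * (N / t) * N + t * (N / t) ^+ 2 = 1 - N ^+ 2 / t.
  by field; rewrite gt_eqF.
by rewrite subr_ge0 ler_pdivrMr// mul1r.
Qed.

(** The trace of [outer v] is the squared norm of [v], and its entrywise l1 norm is the square of
    the l1 norm of [v]. Feasibility of these rank-one matrices is what makes [lhat] a relaxation of
    [lmax]. *)
Lemma outer_Nps (k s : nat) v : (k <= s)%N -> v \in (sparse_sphere k) ->
  Nps s (outer v).
Proof.
move=> ks vk; split; first exact: psd_outer.
split.
  have /set_mem[/set_mem v1 _] := vk; rewrite -[RHS]v1.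
  by apply: eq_bigr => i _; rewrite outerE expr2.
apply: (@le_trans _ _ k%:R); last by rewrite ler_nat.
apply: le_trans (sparse_l1_sqr_le vk).
rewrite le_eqVlt; apply/orP; left; apply/eqP.
rewrite expr2 mulr_suml; apply: eq_bigr => i _; rewrite mulr_sumr.
by apply: eq_bigr => j _; rewrite outerE normrM.
Qed.

Lemma delta_sparse_sphere (s : nat) j : (0 < s)%N ->
  delta_mx j 0 \in (sparse_sphere s : set 'cV[R]_p).
Proof.
move=> s0; rewrite inE; split; first exact: delta_unit_sphere.
have j1 : (#|[set j]%SET| <= s)%N by rewrite cards1.
apply: leq_trans j1; apply: subset_leq_card.
apply/fintype.subsetP => i iv; rewrite finset.in_set1; move: iv; rewrite inE /= mxE eqxx andbT.
by case: (i == j) => //; rewrite eqxx.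
Qed.

Lemma tr_mul_le (s : nat) A Z e : 0 <= e -> (forall i j, `|A i j| <= e) -> Nps s Z ->
  `|\tr (A *m Z)| <= s%:R * e.
Proof.
move=> e0 Ae [[ZT _] [_ Zs]].
apply: (@le_trans _ _ (\sum_i \sum_j e * `|Z i j|)).
  apply: (le_trans (ler_norm_sum _ _ _)); apply: ler_sum => i _.
  rewrite mxE; apply: (le_trans (ler_norm_sum _ _ _)); apply: ler_sum => j _.
  by rewrite normrM -{1}ZT mxE ler_wpM2r.
under eq_bigr do rewrite -mulr_sumr.
by rewrite -mulr_sumr mulrC ler_wpM2r.
Qed.

(** Serves as a crude bound on the entries, so that the sets whose [sup] defines [lhat] and [lmax]
    are bounded above. *)
Definition sum_norm A : R := \sum_i \sum_j `|A i j|.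

Lemma sum_norm_ge0 A : 0 <= sum_norm A.
Proof. by apply: sumr_ge0 => i _; apply: sumr_ge0 => j _. Qed.

Lemma ler_sum_norm A i j : `|A i j| <= sum_norm A.
Proof.
rewrite /sum_norm (bigD1 i)//= (bigD1 j)//= -addrA lerDl addr_ge0 ?sumr_ge0//.
by move=> k _; apply: sumr_ge0.
Qed.

Hypothesis p0 : (0 < p)%N.
Let j0 : 'I_p := Ordinal p0.

Lemma lhat_values_neq0 (s : nat) A : (0 < s)%N ->
  [set `|\tr (A *m Z)| | Z in Nps s] !=set0.
Proof.
move=> s0; exists `|\tr (A *m outer (delta_mx j0 0))| => /=; exists (outer (delta_mx j0 0)) => //.
by apply: (@outer_Nps s) => //; exact: delta_sparse_sphere.
Qed.

Lemma le_lhat (s : nat) A Z : Nps s Z -> `|\tr (A *m Z)| <= lhat s A.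
Proof.
move=> NZ; apply: ub_le_sup; last by exists Z.
exists (s%:R * sum_norm A) => _ [Z' NZ' <-].
by apply: tr_mul_le => //; [exact: sum_norm_ge0|exact: ler_sum_norm].
Qed.

Lemma lhat_le (s : nat) A e : (0 < s)%N -> 0 <= e -> (forall i j, `|A i j| <= e) ->
  lhat s A <= s%:R * e.
Proof.
move=> s0 e0 Ae; apply: ge_sup; first exact: lhat_values_neq0.
by move=> _ [Z NZ <-]; exact: tr_mul_le.
Qed.

Lemma lhat_lipschitz (s : nat) A B e : (0 < s)%N -> 0 <= e ->
  (forall i j, `|A i j - B i j| <= e) -> lhat s A <= lhat s B + s%:R * e.
Proof.
move=> s0 e0 ABe; apply: ge_sup; first exact: lhat_values_neq0.
move=> _ [Z NZ <-]; rewrite -[A](subrK B) mulmxDl linearD addrC.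
apply: (le_trans (ler_normD _ _)); apply: lerD; first exact: le_lhat.
by apply: tr_mul_le => // i j; rewrite !mxE.
Qed.

Lemma lhat_ge_diag (s : nat) A j : (0 < s)%N -> A j j <= lhat s A.
Proof.
move=> s0; apply: le_trans (ler_norm _) _.
have NZ : Nps s (outer (delta_mx j 0)).
  by apply: (@outer_Nps s) => //; exact: delta_sparse_sphere.
apply: le_trans (le_lhat A NZ); rewrite -qform_outer /qform.
rewrite (_ : (_ *m _ *m _) 0 0 = A j j)//.
by rewrite trmx_delta -rowE -colE !mxE.
Qed.

Lemma lhat_ge0 (s : nat) A : (0 < s)%N -> 0 <= lhat s A.
Proof.
move=> s0; have NZ : Nps s (outer (delta_mx j0 0)).
  by apply: (@outer_Nps s) => //; exact: delta_sparse_sphere.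
exact: le_trans (le_lhat A NZ).
Qed.

Lemma lmax_values_neq0 (k : nat) A : (0 < k)%N ->
  [set `|qform A v| | v in sparse_sphere k] !=set0.
Proof.
move=> k0; exists `|qform A (delta_mx j0 0)| => /=; exists (delta_mx j0 0) => //.
exact/set_mem/delta_sparse_sphere.
Qed.

Lemma qform_le (k : nat) A v e : 0 <= e -> (forall i j, `|A i j| <= e) ->
  v \in sparse_sphere k -> `|qform A v| <= k%:R * e.
Proof.
by move=> e0 Ae vk; rewrite qform_outer; apply: tr_mul_le => //; exact: outer_Nps vk.
Qed.

Lemma le_lmax (k : nat) A v : v \in sparse_sphere k -> `|qform A v| <= lmax k A.
Proof.
move=> vk; apply: ub_le_sup; last by exists v => //; exact: set_mem.
exists (k%:R * sum_norm A) => _ [v' vk' <-].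
by apply: qform_le => //; [exact: sum_norm_ge0|exact: ler_sum_norm|exact: mem_set].
Qed.

Lemma lmax_le_lhat (k s : nat) A B e : (0 < k <= s)%N -> 0 <= e ->
  (forall i j, `|A i j - B i j| <= e) -> lmax k A <= lhat s B + k%:R * e.
Proof.
move=> /andP[k0 ks] e0 ABe; apply: ge_sup; first exact: lmax_values_neq0.
move=> _ [v /mem_set vk <-]; rewrite qform_outer -[A](subrK B) mulmxDl linearD addrC.
apply: (le_trans (ler_normD _ _)); apply: lerD.
  by apply: le_lhat; exact: outer_Nps vk.
(* The perturbation is tested on [outer v], which already lies in [Nps k]; the error thus carries
   the factor [k] and not [s]. *)
apply: (@tr_mul_le k) => //; last exact: outer_Nps vk.
by move=> i j; rewrite !mxE.
Qed.

(** At [e = 0] this reads off the diagonal; at [e = 1] and [e = -1] it yields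
    [2 |A j k| <= A j j + A k k] for positive definite [A]. *)
Lemma qform_deltaD A j k (e : R) : A^T = A ->
  qform A (delta_mx j 0 + e *: delta_mx k 0) = A j j + e *+ 2 * A j k + e ^+ 2 * A k k.
Proof.
move=> AT; have Akj : A k j = A j k by rewrite -[in LHS]AT mxE.
have E a b : (delta_mx 0 a : 'rV[R]_p) *m A *m delta_mx b 0 = (A a b)%:M.
  by apply/matrixP => x y; rewrite !ord1 -rowE -colE !mxE mulr1n.
have -> : qform A (delta_mx j 0 + e *: delta_mx k 0) =
    (((delta_mx 0 j : 'rV[R]_p) + e *: delta_mx 0 k) *m A *m
     ((delta_mx j 0 : 'cV[R]_p) + e *: delta_mx k 0)) 0 0.
  by rewrite /qform; congr ((_ *m _ *m _) 0 0); rewrite linearD linearZ /= !trmx_delta.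
rewrite !mulmxDl !mulmxDr.
by rewrite -!scalemxAl -!scalemxAr !E !mxE !mulr1n Akj; ring.
Qed.

Lemma posdef_diag_gt0 A j : posdef A -> 0 < A j j.
Proof.
move=> [AT Apos]; have := qform_deltaD j j 0 AT.
rewrite scale0r addr0 mul0rn mul0r expr0n mul0r !addr0 => <-.
apply: Apos; apply/negP => /eqP /matrixP /(_ j 0); rewrite !mxE !eqxx => /eqP.
by rewrite oner_eq0.
Qed.

Lemma posdef_qform_ge0 A v : posdef A -> 0 <= qform A v.
Proof.
move=> [_ Apos]; have [->|/Apos/ltW//] := eqVneq v 0.
by rewrite /qform mulmx0 mxE.
Qed.

Lemma posdef_entry_le A M : posdef A -> (forall j, A j j <= M) ->
  forall j k, `|A j k| <= M.
Proof.
move=> Apd AM j k; have [AT _] := Apd.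
have h1 := posdef_qform_ge0 (delta_mx j 0 + 1 *: delta_mx k 0) Apd.
have h2 := posdef_qform_ge0 (delta_mx j 0 + (-1) *: delta_mx k 0) Apd.
rewrite !qform_deltaD// in h1 h2; have := AM j; have := AM k.
by rewrite ler_norml => ? ?; apply/andP; split; lra.
Qed.

Lemma lmax_ge_diag (k : nat) A j : (0 < k)%N -> A j j <= lmax k A.
Proof.
move=> k0; apply: le_trans (ler_norm _) _.
apply: le_trans (le_lmax A (delta_sparse_sphere j k0)); rewrite /qform.
rewrite (_ : (_ *m _ *m _) 0 0 = A j j)//.
by rewrite trmx_delta -rowE -colE !mxE.
Qed.

(** Both quadratic forms lie in [[0, M]], so their difference lies in [[-M, M]]; positivity saves
    the factor 2 of the triangle inequality. In [detection_bound] this keeps the target rate at most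
    1. *)
Lemma omega_le1 (k : nat) A B : (0 < k)%N -> posdef A -> posdef B ->
  omega k A B <= 1.
Proof.
move=> k0 pA pB; set M := Num.max (lmax k A) (lmax k B).
have M0 : 0 < M.
  rewrite lt_max; apply/orP; left.
  exact: lt_le_trans (posdef_diag_gt0 j0 pA) (lmax_ge_diag _ _ k0).
rewrite /omega -/M ler_pdivrMr// mul1r.
apply: ge_sup; first exact: lmax_values_neq0.
move=> _ [v /mem_set vk <-].
have -> : qform (A - B) v = qform A v - qform B v.
  by rewrite /qform mulmxBr mulmxBl !mxE.
have a0 := posdef_qform_ge0 v pA; have b0 := posdef_qform_ge0 v pB.
have aM : qform A v <= M.
  rewrite le_max; apply/orP; left; apply: le_trans (ler_norm _) _; exact: le_lmax.
have bM : qform B v <= M.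
  rewrite le_max; apply/orP; right; apply: le_trans (ler_norm _) _; exact: le_lmax.
by rewrite ler_norml; apply/andP; split; lra.
Qed.

End SparseEigenvalues.

Section MeasurableLhat.
Context {R : realType} {p : nat} {d : measure_display} {T : measurableType d}.

(* Since lhat s is Lipschitz in the entries, its superlevel sets are countable
   unions of entrywise balls around rational matrices. *)
Lemma measurable_lhat (s : nat) (A : T -> 'M[R]_p) : (0 < p)%N -> (0 < s)%N ->
  (forall i j, measurable_fun setT (fun x => A x i j)) ->
  measurable_fun setT (fun x => lhat s (A x)).
Proof.
move=> p0 s0 mA mD; apply: (measurability _ (RGenOInfty.measurableE R)) => //.
move=> /= _ [_ [a ->] <-]; rewrite preimage_itvoy setTI.
have s0R : 0 < s%:R :> R by rewrite ltr0n.
pose e (n : nat) : R := n.+1%:R^-1; have e0 n : 0 < e n by rewrite invr_gt0.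
pose Q (B : 'M[rat]_p) : 'M[R]_p := map_mx ratr B.
pose F (Bn : 'M[rat]_p * nat) : set T :=
  [set x | a + s%:R * e Bn.2 < lhat s (Q Bn.1) /\
     forall i j, `|A x i j - Q Bn.1 i j| <= e Bn.2].
rewrite [X in measurable X](_ : _ = \bigcup_Bn F Bn).
  apply: countable_bigcupT_measurable => // -[B n]; rewrite /F /=.
  have [aB|aB] := boolP (a + s%:R * e n < lhat s (Q B)); last first.
    by rewrite (_ : [set _ | _] = set0)//; apply/seteqP; split => x// [].
  rewrite (_ : [set x | _] = \bigcap_i \bigcap_j
     ~` [set x | e n < `|A x i j - Q B i j|]); last first.
    apply/seteqP; split => [x [_ H] i _ j _ /=|x H].
      by apply/negP; rewrite -leNgt.
    by split => // i j; rewrite leNgt; apply/negP; exact: H.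
  apply: fin_bigcap_measurable => // i _; apply: fin_bigcap_measurable => // j _.
  apply: measurableC; apply: measurable_gt.
  by apply: measurableT_comp (@normr_measurable R setT) _; exact: measurable_funB.
apply/seteqP; split => x /=; last first.
  move=> [[B n] _ [/= aB AB]].
  have : lhat s (Q B) <= lhat s (A x) + s%:R * e n.
    by apply: lhat_lipschitz => //; [exact: ltW|move=> i j; rewrite distrC].
  lra.
move=> ax.
have [n nP] : exists n, a + 2 * (s%:R * e n) < lhat s (A x).
  have : 0 < (lhat s (A x) - a) / (2 * s%:R).
    by rewrite divr_gt0 ?subr_gt0// mulr_gt0.
  move=> /ltr_add_invr[n]; rewrite add0r -/(e n) ltr_pdivlMr ?mulr_gt0// => H.
  by exists n; lra.
have /choice[b bP] (ij : 'I_p * 'I_p) : exists b : rat, `|A x ij.1 ij.2 - ratr b| <= e n.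
  have /rat_in_itvoo[b bP] : A x ij.1 ij.2 - e n < A x ij.1 ij.2 by rewrite gtrBl.
  exists b; move: bP; rewrite in_itv/= => /andP[b1 b2].
  by rewrite ger0_norm ?subr_ge0 ?(ltW b2)//; lra.
have bAe i j : `|A x i j - Q (\matrix_(i, j) b (i, j)) i j| <= e n.
  by rewrite !mxE; exact: (bP (i, j)).
exists (\matrix_(i, j) b (i, j), n) => //; split => //=.
have := lhat_lipschitz p0 s0 (ltW (e0 n)) bAe; lra.
Qed.

End MeasurableLhat.

(** * Alarms *)

Section UnionBounds.
Context {R : realType} {d : measure_display} {T : measurableType d}.
Variable P : probability T R.

Lemma probability_bigcup_seq_le (U : choiceType) (r : seq U) (F : U -> set T) (c : R) :
    (forall i, i \in r -> measurable (F i)) ->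
    (forall i, i \in r -> (P (F i) <= c%:E)%E) ->
  (P (\bigcup_(i in [set` r]) F i) <= ((size r)%:R * c)%:E)%E.
Proof.
rewrite bigcup_seq; elim: r => [|i r IH] mF Fc.
  by rewrite big_nil measure0 mul0r.
have mFr j : j \in r -> measurable (F j).
  by move=> jr; apply: mF; rewrite inE jr orbT.
rewrite big_cons; apply: (@le_trans _ _ (P (F i) + P (\big[setU/set0]_(j <- r) F j))%E).
  apply: measureU2; first by apply: mF; rewrite mem_head.
  by rewrite -bigcup_seq; apply: fin_bigcup_measurable.
rewrite /= -natr1 mulrDl mul1r EFinD [leRHS]addeC; apply: leeD.
  by apply: Fc; rewrite mem_head.
by apply: IH => // j jr; apply: Fc; rewrite inE jr orbT.
Qed.

Lemma probability_bigcup_le (F : nat -> set T) (e : nat -> R) (c : R) :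
    (forall n, measurable (F n)) -> (forall n, (P (F n) <= (e n)%:E)%E) ->
    (forall n, \sum_(0 <= i < n) e i <= c) ->
  (P (\bigcup_n F n) <= c%:E)%E.
Proof.
move=> mF Fe ec.
apply: (le_trans (measure_sigma_subadditive P mF _ _)); first exact: bigcup_measurable.
  by [].
apply: (lime_le (is_cvg_nneseries (fun n _ _ => measure_ge0 P (F n)))).
apply: nearW => n; apply: (@le_trans _ _ (\sum_(0 <= i < n) (e i)%:E)%E).
  by apply: lee_sum => i _; exact: Fe.
by rewrite sumEFin lee_fin.
Qed.

Lemma probability_setC_ge (A B : set T) (c : R) : measurable A -> measurable B ->
  ~` A `<=` B -> (P A <= c%:E)%E -> ((1 - c)%:E <= P B)%E.
Proof.
move=> mA mB AB Ac; apply: (@le_trans _ _ (P (~` A))).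
  by rewrite probability_setC// EFinB; apply: leeB.
by apply: le_measure => //; rewrite inE//; exact: measurableC.
Qed.

End UnionBounds.

Section Sums.
Context {R : realType}.

(** Telescoping: [1 / (t + 2)^2 <= 1 / (t + 1) - 1 / (t + 2)]. The shift by 2 matches the first
    possible alarm time. *)
Lemma sum_inv_sqr_le1 n : \sum_(0 <= t < n) (t.+2%:R ^+ 2)^-1 <= 1 :> R.
Proof.
suff: \sum_(0 <= t < n) (t.+2%:R ^+ 2)^-1 <= 1 - n.+1%:R^-1 :> R.
  by move=> /le_trans; apply; rewrite gerBl invr_ge0.
elim: n => [|n IH]; first by rewrite big_nil invr1 subrr.
rewrite big_nat_recr//=; apply: (le_trans (lerD IH (lexx _))).
have -> : n.+2%:R = n.+1%:R + 1 :> R by rewrite natr1.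
have : 0 < n.+1%:R :> R by [].
move: (n.+1%:R : R) => z z0.
have -> : (1 - (z + 1)^-1) = 1 - z^-1 + (z * (z + 1))^-1.
  by field; rewrite !gt_eqF//; lra.
rewrite lerD2l lef_pV2 ?posrE ?exprn_gt0 ?mulr_gt0//; nra.
Qed.

(** Comparison with a geometric series through [2 ^ r >= r + 1]: all dyadic windows together cost at
    most twice the shortest one, a single observation. *)
Lemma sum_expn2_le (q : R) n : 0 < q -> q <= 2^-1 ->
  \sum_(0 <= r < n) q ^+ (2 ^ r) <= 2 * q.
Proof.
move=> q0 q12.
suff: \sum_(0 <= r < n) q ^+ (2 ^ r) <= 2 * q - 2 * q ^+ n.+1.
  by move=> /le_trans; apply; rewrite gerBl mulr_ge0// exprn_ge0// ltW.
elim: n => [|n IH]; first by rewrite big_nil expr1 subrr.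
rewrite big_nat_recr//=; apply: (le_trans (lerD IH (lexx _))).
have h : q ^+ (2 ^ n) <= q ^+ n.+1.
  by rewrite ler_wiXn2l// ?ltW//; [lra|exact: ltn_expl].
have : 0 < q ^+ n.+1 by exact: exprn_gt0.
rewrite [q ^+ n.+2]exprS; nra.
Qed.

(** With [0 <= c], the default value 0 of the maximum cannot itself exceed [c]. *)
Lemma bigmax_gtP (c : R) (r : seq nat) (Q : pred nat) (F : nat -> R) : 0 <= c ->
  (c < \big[Num.max/0]_(i <- r | Q i) F i) <->
  exists i, [/\ i \in r, Q i & c < F i].
Proof.
move=> c0; elim: r => [|i r IH].
  by rewrite big_nil ltNge c0; split => // -[i []].
rewrite big_cons; case: ifPn => [Qi|Qi].
  rewrite lt_max; split => [/orP[ci|/IH[k [kr Qk ck]]]|[k []]].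
  - by exists i; rewrite mem_head.
  - by exists k; rewrite inE kr orbT.
  - rewrite inE => /orP[/eqP->|kr] Qk ck; first by rewrite ck.
    by apply/orP; right; apply/IH; exists k.
rewrite IH; split => -[k [kr Qk ck]]; exists k; split => //; first by rewrite inE kr orbT.
by move: kr; rewrite inE => /orP[/eqP ki|//]; rewrite -ki Qk in Qi.
Qed.

End Sums.

(** * Density of the grids of window lengths and sparsities *)

Section Grid.

Lemma grid_gt0 t g : g \in grid t -> (0 < g)%N.
Proof.
rewrite inE => /orP[/eqP->//|]; rewrite mem_cat => /orP[|] /mapP[j _ ->].
  by rewrite /gL addn_gt0 expn_gt0.
by rewrite /gR /gL !addn_gt0 expn_gt0.
Qed.

(** The left point of level j, where 2^j is the largest power of two not above h/2: its offset is
    less than 2^(j-1), so it stays below (3/2) 2^j and hence below h, while h < 4 * 2^j. The level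
    belongs to the grid because 2h <= t. For h < 4 such a level would not be positive, and g = 1 is
    taken. *)
Lemma grid_dense t h : (0 < h)%N -> (2 * h <= t)%N ->
  exists g, [/\ g \in grid t, (0 < g)%N, (g <= h)%N & (h <= 4 * g)%N].
Proof.
move=> h0 ht; have [h4|h4] := ltnP h 4.
  by exists 1%N; rewrite mem_head; split => //; lia.
have h2 : (2 <= h %/ 2)%N by lia.
pose j := trunc_log 2 (h %/ 2).
have j0 : (0 < j)%N by rewrite trunc_log_gt0//; lia.
have jl : (2 ^ j <= h %/ 2)%N by apply: trunc_logP => //; lia.
have jr : (h %/ 2 < 2 ^ j.+1)%N by exact: trunc_log_ltn.
have jE : (2 ^ j = 2 * 2 ^ j.-1)%N by rewrite -expnS prednK.
have jl1 : (t.-1 %% 2 ^ j.-1 < 2 ^ j.-1)%N by rewrite ltn_mod expn_gt0.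
rewrite expnS in jr.
have gE : gL t j = (2 ^ j + t.-1 %% 2 ^ j.-1)%N by [].
exists (gL t j); split; rewrite ?gE; [|by rewrite addn_gt0 expn_gt0|lia|lia].
rewrite -gE inE mem_cat; apply/orP; right; apply/orP; left; apply/map_f.
rewrite mem_iota /nL; have -> : (3 <= t.-1)%N by lia.
rewrite add1n ltnS j0 /= -{1}(prednK j0) ltnS.
apply: trunc_log_max => //; lia.
Qed.

Lemma Sset_gt0 p s : (0 < p)%N -> s \in Sset p -> (0 < s)%N.
Proof.
move=> p0; rewrite /Sset mem_rcons inE => /orP[/eqP->//|/mapP[e _ ->]].
by rewrite expn_gt0.
Qed.

(** The witness is the first power of two above [k], or [p] itself when that power exceeds [p]. *)
Lemma Sset_dense p k : (0 < k <= p)%N ->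
  exists s, [/\ s \in Sset p, (k <= s)%N & (s <= 2 * k)%N].
Proof.
move=> /andP[k0 kp]; pose e := trunc_log 2 k.
have el : (2 ^ e <= k)%N by exact: trunc_logP.
have er : (k < 2 ^ e.+1)%N by exact: trunc_log_ltn.
have [ep|ep] := leqP (2 ^ e.+1) p; last first.
  exists p; rewrite /Sset mem_rcons mem_head; split => //.
  by rewrite expnS in ep; lia.
exists (2 ^ e.+1)%N; split; [|exact: ltnW|by rewrite expnS leq_mul2l].
rewrite /Sset mem_rcons inE; apply/orP; right; apply/map_f.
by rewrite mem_iota/= add0n ltnS; apply: trunc_log_max.
Qed.

End Grid.

Section SampleWindows.
Context {R : realType} {T : Type} {p : nat}.
Variable Y : nat -> 'I_p -> T -> R.

Definition base_window (g : nat) : seq nat := index_iota 1 (2 ^ trunc_log 2 g).+1.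
Definition test_window (t g : nat) : seq nat := index_iota (t - g + 1) t.+1.

Lemma size_base_window g : size (base_window g) = (2 ^ trunc_log 2 g)%N.
Proof. by rewrite size_iota subSS subn0. Qed.

Lemma size_test_window t g : (g <= t)%N -> size (test_window t g) = g.
Proof. by move=> gt; rewrite size_iota; lia. Qed.

Lemma mem_base_window g i : i \in base_window g -> (0 < i <= 2 ^ trunc_log 2 g)%N.
Proof. by rewrite mem_index_iota ltnS. Qed.

Lemma mem_test_window t g i : i \in test_window t g -> (t - g < i <= t)%N.
Proof. by rewrite mem_index_iota addn1 ltnS. Qed.

Lemma base_window_gt0 g : all (fun i => 0 < i)%N (base_window g).
Proof. by apply/allP => i /mem_base_window/andP[]. Qed.

Lemma test_window_gt0 t g : all (fun i => 0 < i)%N (test_window t g).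
Proof. by apply/allP => i /mem_test_window/andP[+ _]; exact: leq_ltn_trans. Qed.

Lemma Sig1E g x j k : Sig1 Y g x j k = sample_moment Y (base_window g) j k x.
Proof.
rewrite /sample_moment size_base_window !mxE summxE; congr (_ * _).
by apply: eq_bigr => i _; rewrite -/(outer _) outerE !mxE.
Qed.

Lemma Sig2E t g x j k : (g <= t)%N ->
  Sig2 Y t g x j k = sample_moment Y (test_window t g) j k x.
Proof.
move=> gt; rewrite /sample_moment size_test_window// !mxE summxE; congr (_ * _).
by apply: eq_bigr => i _; rewrite -/(outer _) outerE !mxE.
Qed.

End SampleWindows.

Section Alarms.
Context {R : realType} {d : measure_display} {T : measurableType d}.
Variables (P : probability T R) (p : nat) (lam : R) (Y : nat -> 'I_p -> T -> R).
Hypothesis p0 : (0 < p)%N.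
Hypothesis lam0 : 0 < lam.

Lemma xiE t g s : xi p lam t g s = lam * s%:R * rate (ln (maxn p t)%:R) g%:R.
Proof. by []. Qed.

(* Tstat divides by the threshold, and x / 0 = 0: a null threshold never raises
   an alarm. *)
Definition alarm (t g s : nat) (x : T) : Prop :=
  0 < sighat2 Y g x * xi p lam t g s /\
  sighat2 Y g x * xi p lam t g s < lhat s (Sig1 Y g x - Sig2 Y t g x).

Lemma rate_ge0 (L m : R) : 0 <= rate L m.
Proof. by rewrite le_max sqrtr_ge0. Qed.

Lemma threshold_ge0 t g s x : 0 <= sighat2 Y g x * xi p lam t g s.
Proof.
rewrite mulr_ge0//; first exact: lhat_ge0.
by rewrite xiE; apply: mulr_ge0; [rewrite mulr_ge0// ltW|exact: rate_ge0].
Qed.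

Lemma alarm_timesP t x : alarm_times lam Y x t <->
  (2 <= t)%N /\ exists g s, [/\ g \in grid t, (2 * g <= t)%N, s \in Sset p & alarm t g s x].
Proof.
have gt1E (a b : R) : 0 <= b -> 1 < a / b <-> 0 < b /\ b < a.
  rewrite le_eqVlt => /orP[/eqP<-|b0].
    by rewrite invr0 mulr0 ltxx ltr10; split => // -[].
  by rewrite ltr_pdivlMr// mul1r b0; split => // -[].
rewrite /alarm_times /=; split => -[t2].
  move=> /(bigmax_gtP _ _ _ (lexx 0))[g [gG gt]].
  rewrite /Tstat; case: asboolP; last by rewrite ltxx.
  move=> /(bigmax_gtP _ _ _ ler01)[s [sS _ /gt1E H]] _.
  by split => //; exists g, s; split => //; apply: H; exact: threshold_ge0.
move=> [g [s [gG gt sS /gt1E H]]]; split => //.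
apply/(bigmax_gtP _ _ _ (lexx 0)); exists g; split => //.
rewrite /Tstat; case: asboolP => // -[]; apply/(bigmax_gtP _ _ _ ler01).
by exists s; split => //; apply: H; exact: threshold_ge0.
Qed.

Hypothesis regY : regular P Y.

Lemma measurable_alarm t g s : (g <= t)%N -> (0 < s)%N ->
  measurable [set x | alarm t g s x].
Proof.
move=> gt s0.
have m1 j k : measurable_fun setT (fun x => Sig1 Y g x j k).
  under eq_fun do rewrite Sig1E; apply: (measurable_sample_moment regY).
  exact: base_window_gt0.
have m2 j k : measurable_fun setT (fun x => Sig2 Y t g x j k).
  under eq_fun do rewrite Sig2E//; apply: (measurable_sample_moment regY).
  exact: test_window_gt0.
have ms : measurable_fun setT (fun x => sighat2 Y g x * xi p lam t g s).
  by apply: measurable_funM => //; apply: measurable_lhat.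
have ml : measurable_fun setT (fun x => lhat s (Sig1 Y g x - Sig2 Y t g x)).
  apply: measurable_lhat => // i j; under eq_fun do rewrite mxE [X in _ + X]mxE.
  exact: measurable_funB.
rewrite (_ : [set _ | _] = [set x | 0 < sighat2 Y g x * xi p lam t g s] `&`
  [set x | 0 < lhat s (Sig1 Y g x - Sig2 Y t g x) - sighat2 Y g x * xi p lam t g s]).
  by apply: measurableI; apply: measurable_gt => //; exact: measurable_funB.
by apply/seteqP; split => x /=; rewrite /alarm subr_gt0.
Qed.

Lemma measurable_alarm_times t : measurable [set x | alarm_times lam Y x t].
Proof.
have [t2|t2] := leqP 2 t; last first.
  rewrite (_ : [set _ | _] = set0)//; apply/seteqP; split => x //=.
  by rewrite alarm_timesP leqNgt t2 => -[].
rewrite (_ : [set _ | _] = \bigcup_(g in [set g | g \in grid t /\ (2 * g <= t)%N])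
    \bigcup_(s in [set s | s \in Sset p]) [set x | alarm t g s x]).
  apply: bigcup_measurable => g [gG gt]; apply: bigcup_measurable => s sS.
  by apply: measurable_alarm; [lia|exact: Sset_gt0 sS].
apply/seteqP; split => x /=; rewrite alarm_timesP.
  by move=> [_ [g [s [gG gt sS H]]]]; exists g => //; exists s.
by move=> [g [gG gt] [s sS H]]; split => //; exists g, s.
Qed.

Lemma tauhat_ltyE : [set x | (tauhat lam Y x < +oo)%E] =
  \bigcup_t [set x | alarm_times lam Y x t].
Proof.
apply/seteqP; split => x /=.
  by move=> /ereal_inf_lt[_ [t tx <-] _]; exists t.
move=> [t _ tx]; apply: (@le_lt_trans _ _ (t%:R)%:E); last by rewrite ltry.
by apply: ereal_inf_lbound; exists t.
Qed.

Lemma tauhat_leE N : [set x | (tauhat lam Y x <= (N%:R)%:E)%E] =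
  \bigcup_(t in [set t | (t <= N)%N]) [set x | alarm_times lam Y x t].
Proof.
apply/seteqP; split => x /=; last first.
  move=> [t tN tx]; apply: (@le_trans _ _ (t%:R)%:E); last by rewrite lee_fin ler_nat.
  by apply: ereal_inf_lbound; exists t.
(* Passing to a strict bound at [N + 1] produces an actual alarm time below [N + 1], hence at most
   [N], without first showing that the infimum is attained. *)
move=> tauN; have : (tauhat lam Y x < (N.+1%:R)%:E)%E.
  by apply: le_lt_trans tauN _; rewrite lte_fin ltr_nat.
move=> /ereal_inf_lt[_ [t tx <-]]; rewrite lte_fin ltr_nat ltnS => tN.
by exists t.
Qed.

End Alarms.

(** * Simultaneous deviations of all entries over a window *)

Section Windows.
Context {R : realType} {d : measure_display} {T : measurableType d}.
Variables (P : probability T R) (p : nat) (Y : nat -> 'I_p -> T -> R) (u : R).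
Hypothesis regY : regular P Y.
Hypothesis indY : indep_vectors P Y.
Hypothesis CY : condC P Y u.
Hypothesis u0 : 0 < u.

Definition window_deviation (I : seq nat) (S : 'M[R]_p) (e : R) : set T :=
  \bigcup_(jk in [set` enum {: 'I_p * 'I_p}]) deviation Y I jk.1 jk.2 (S jk.1 jk.2) e.

Lemma measurable_window_deviation I S e : all (fun i => 0 < i)%N I ->
  measurable (window_deviation I S e).
Proof.
move=> I0; apply: fin_bigcup_measurable => // jk _.
exact: (measurable_deviation regY).
Qed.

Lemma not_window_deviation I S e x : ~ window_deviation I S e x ->
  forall j k, `|sample_moment Y I j k x - S j k| < e.
Proof.
move=> nx j k; rewrite ltNge; apply/negP => H; apply: nx.
by exists (j, k) => //=; rewrite mem_enum.
Qed.

(* Chosen so that the exponent of deviation_le is n + 2: two powers of p \/ t pay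
   for the union bound over the p ^ 2 entries. *)
Definition level (n : nat) : R := 2 * n.+2%:R + 64.

Lemma level_ge0 n : 0 <= level n.
Proof. by rewrite addr_ge0// mulr_ge0. Qed.

Lemma window_deviation_le I S M N n : uniq I -> all (fun i => 0 < i)%N I ->
    (0 < size I)%N -> (forall i, i \in I -> Sigma P Y i = S) ->
    (forall j, 0 < S j j <= M) -> 0 < M -> (p <= N)%N -> (1 < N)%N ->
  (P (window_deviation I S (2 * u * M * (level n * rate (ln N%:R) (size I)%:R)))
     <= (2 * (N%:R ^+ n)^-1)%:E)%E.
Proof.
move=> uI I0 szI SI SM M0 pN N1.
have K0 : 0 < 2 * u * M by rewrite !mulr_gt0.
have L0 : 0 < ln (N%:R : R) by rewrite ln_gt0// ltr1n.
have N0 : 0 < N%:R :> R by rewrite ltr0n; exact: ltn_trans N1.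
have YK i l : i \in I ->
    (\int[P]_x (expR (Y i l x ^+ 2 / (2 * u * M)))%:E <= 2%:E)%E.
  move=> iI; have /andP[S0 SlM] := SM l.
  apply: (@condC_expR_sqr _ _ _ P p Y regY u) => //.
  - exact: (allP I0).
  - by rewrite SI.
  - by rewrite SI// ler_wpM2l// mulr_ge0// ltW.
apply: le_trans (probability_bigcup_seq_le (c := 2 * (N%:R ^+ n.+2)^-1) _ _) _.
- by move=> jk _; exact: (measurable_deviation regY).
- move=> [j k] _.
  have -> : 2 * (N%:R ^+ n.+2)^-1 = 2 * expR (- (level n / 2 - 32) * ln N%:R) :> R.
    congr (2 * _); have -> : - (level n / 2 - 32) * ln N%:R = - (n.+2%:R * ln (N%:R : R)).
      by rewrite /level; field.
    by rewrite expRN expRM_natl lnK// posrE.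
  apply: (deviation_le regY indY) => //; first exact: level_ge0.
  by move=> i iI; rewrite SI.
- rewrite -cardE card_prod card_ord lee_fin natrM.
  have -> : N%:R ^+ n.+2 = N%:R * N%:R * N%:R ^+ n :> R by rewrite !exprS mulrA.
  have pNR : p%:R <= N%:R :> R by rewrite ler_nat.
  have pN2 : p%:R * p%:R / (N%:R * N%:R) <= 1 :> R.
    by rewrite ler_pdivrMr ?mulr_gt0// mul1r; apply: ler_pM.
  have Nn : 0 < (N%:R ^+ n)^-1 :> R by rewrite invr_gt0 exprn_gt0.
  rewrite [(_ * N%:R ^+ n)^-1]invfM.
  rewrite (_ : _ * _ * (2 * _) = p%:R * p%:R / (N%:R * N%:R) * (2 * (N%:R ^+ n)^-1)).
    by rewrite ler_piMl// mulr_ge0// ltW.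
  by ring.
Qed.

End Windows.

Section Rates.
Context {R : realType}.

(** Meant for the base window: its length m is the largest power of two not above g, whereas the
    threshold is expressed with g. *)
Lemma rate_double (L m g : R) : 0 <= L -> 0 < m -> 0 < g -> g <= 2 * m ->
  rate L m <= 2 * rate L g.
Proof.
move=> L0 m0 g0 gm.
have mg : m^-1 <= 2 * g^-1.
  by rewrite -[m^-1]mul1r ler_pdivrMr// mulrAC ler_pdivlMr// mul1r.
have Lm2 : L / m <= 2 * (L / g) by rewrite mulrCA ler_wpM2l.
have Lm : L / m <= 2 ^+ 2 * (L / g).
  have : 0 <= L / g by rewrite divr_ge0// ltW.
  by rewrite expr2; lra.
rewrite /rate ge_max; apply/andP; split.
  apply: (@le_trans _ _ (2 * Num.sqrt (L / g))); last first.
    by rewrite ler_wpM2l// le_max lexx.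
  by apply: le_trans (ler_wsqrtr Lm) _; rewrite sqrtrM ?sqr_ge0// sqrtr_sqr ger0_norm.
by apply: le_trans Lm2 _; rewrite ler_wpM2l// le_max lexx orbT.
Qed.

End Rates.

Section GoodWindows.
Context {R : realType} {d : measure_display} {T : measurableType d} {p : nat}.
Variable Y : nat -> 'I_p -> T -> R.

(** The base window contributes 2, by [rate_double], and the test window, of length exactly g,
    contributes 1; hence 3. *)
Lemma good_windows (S1 S2 : 'M[R]_p) (K a L : R) t g x :
    0 <= K -> 0 <= a -> 0 <= L -> (0 < g)%N -> (g <= t)%N ->
    ~ window_deviation Y (base_window g) S1
        (K * (a * rate L (size (base_window g))%:R)) x ->
    ~ window_deviation Y (test_window t g) S2
        (K * (a * rate L (size (test_window t g))%:R)) x ->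
  (forall j k, `|Sig1 Y g x j k - S1 j k| <= 2 * (K * (a * rate L g%:R))) /\
  (forall j k, `|(S1 - S2) j k - (Sig1 Y g x - Sig2 Y t g x) j k|
     <= 3 * (K * (a * rate L g%:R))).
Proof.
move=> K0 a0 L0 g0 gt /not_window_deviation n1 /not_window_deviation n2.
have b1 j k : `|Sig1 Y g x j k - S1 j k| <= 2 * (K * (a * rate L g%:R)).
  rewrite Sig1E; apply: le_trans (ltW (n1 j k)) _.
  rewrite [leRHS]mulrCA ler_wpM2l// [leRHS]mulrCA ler_wpM2l// rate_double ?ltr0n//.
    by rewrite size_base_window expn_gt0.
  rewrite -natrM ler_nat size_base_window -expnS ltnW//; exact: trunc_log_ltn.
split => // j k; have {n2} := ltW (n2 j k).
rewrite -Sig2E// size_test_window// => b2.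
have -> : (S1 - S2) j k - (Sig1 Y g x - Sig2 Y t g x) j k =
   (Sig2 Y t g x j k - S2 j k) - (Sig1 Y g x j k - S1 j k).
  by rewrite mxE [X in S1 j k + X]mxE mxE [X in - (_ + X)]mxE; ring.
apply: (le_trans (ler_normB _ _)).
have := b1 j k; lra.
Qed.

End GoodWindows.

(** * Probability of a false alarm *)

Section FalseAlarms.
Context {R : realType} {d : measure_display} {T : measurableType d}.
Variables (P : probability T R) (p : nat) (Y : nat -> 'I_p -> T -> R).
Hypothesis p0 : (0 < p)%N.

Definition low_moment (g : nat) (j : 'I_p) (e : R) : set T :=
  [set x | sample_moment Y (base_window g) j j x <= e].

Lemma measurable_low_moment g j e : regular P Y -> measurable (low_moment g j e).
Proof.
move=> regY; rewrite (_ : low_moment g j e =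
    ~` [set x | e < sample_moment Y (base_window g) j j x]).
  apply/measurableC/measurable_gt/(measurable_sample_moment regY).
  exact: base_window_gt0.
by apply/seteqP; split => x /=; rewrite /low_moment /= leNgt => /negP.
Qed.

Lemma max_diag (S : 'M[R]_p) : exists j, forall k, S k k <= S j j.
Proof.
case: (@arg_maxP _ R 'I_p (Ordinal p0) predT (fun j => S j j)) => // j _ jP.
by exists j => k; exact: jP.
Qed.

(** Outside the bad events the statistic is at most [s * 3 * (2 * u * s2) * level * rho], and the
    threshold is at least [c * s2 * lam * s * rho]. The factors [s], [s2] and [rho] cancel, leaving
    the hypothesis that relates [lam] to [c]. In the bound, [2 * q] pays for the scale estimates and
    the other term for the deviations. *)
Lemma false_alarm_bound (w u lam c q : R) (n : nat) :
    0 < u -> 0 < lam -> 0 < c -> 0 < q <= 2^-1 -> lower_tail w q c ->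
    6 * u * level n.+3 <= c * lam -> model_infty P Y w u ->
  (P [set x | tauhat lam Y x < +oo]%E <= (2 * q + 4 * (2 ^+ n)^-1)%:E)%E.
Proof.
move=> u0 lam0 c0 /andP[q0 q12] lowq uc [regY [[indY _] [BY [CY [lawY pdS]]]]].
set S := Sigma P Y 1 in pdS.
have SE i : (0 < i)%N -> Sigma P Y i = S.
  by move=> i0; apply: (same_law_Sigma regY) => //; exact: lawY.
(* The same number [s2] bounds all variances in the deviation inequality and is the scale in the
   lower tail; a smaller coordinate would leave an uncontrolled ratio of variances. *)
have [j jmax] := max_diag S; set s2 := S j j in jmax.
have s20 : 0 < s2 by exact: posdef_diag_gt0.
pose N t := maxn p t.
pose K := 2 * u * s2; have K0 : 0 < K by rewrite !mulr_gt0.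
pose wd t I := window_deviation Y I S (K * (level n.+3 * rate (ln (N t)%:R) (size I)%:R)).
(* All lengths up to [t] are included. The exponent [n + 3] pays [t] for this union and [t ^ 2] for
   summability over [t]; the remaining [n] powers give [2 ^ - n]. *)
pose bad t : set T := \bigcup_(g in [set` iota 1 t])
  (if (g <= t)%N then wd t (base_window g) `|` wd t (test_window t g) else set0).
(* One index enumerates two unrelated families: the base windows of length [2 ^ r] and the times
   [t = r + 2]. *)
pose F r := low_moment (2 ^ r) j (c * s2) `|` bad r.+2.
have mwd t I : all (fun i => 0 < i)%N I -> measurable (wd t I).
  exact: (measurable_window_deviation regY).
have mB t g : measurable
   (if (g <= t)%N then wd t (base_window g) `|` wd t (test_window t g) else set0).
  case: ifP => // _; apply: measurableU; apply: mwd; [exact: base_window_gt0|].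
  exact: test_window_gt0.
have mbad t : measurable (bad t) by apply: fin_bigcup_measurable.
have mF r : measurable (F r).
  by apply: measurableU => //; exact: measurable_low_moment.
have wdP t I : (1 < t)%N -> uniq I -> all (fun i => 0 < i)%N I -> (0 < size I)%N ->
    (P (wd t I) <= (2 * ((N t)%:R ^+ n.+3)^-1)%:E)%E.
  move=> t1 uI I0 szI; apply: (window_deviation_le regY indY CY) => //.
  - by move=> i iI; apply: SE; exact: (allP I0).
  - by move=> k; rewrite jmax andbT; exact: posdef_diag_gt0.
  - by rewrite leq_maxl.
  - by rewrite leq_max t1 orbT.
have badP t : (1 < t)%N ->
    (P (bad t) <= (4 * (2 ^+ n)^-1 * (t%:R ^+ 2)^-1)%:E)%E.
  move=> t1.
  apply: le_trans (probability_bigcup_seq_le (c := 4 * ((N t)%:R ^+ n.+3)^-1) _ _) _.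
  - by move=> g _; exact: mB.
  - move=> g; rewrite mem_iota add1n ltnS => /andP[g0 gt]; rewrite gt.
    apply: (le_trans (measureU2 _ _ _)).
    + by apply: mwd; exact: base_window_gt0.
    + by apply: mwd; exact: test_window_gt0.
    have -> : 4 * ((N t)%:R ^+ n.+3)^-1 = 2 * ((N t)%:R ^+ n.+3)^-1 + 2 * ((N t)%:R ^+ n.+3)^-1 :> R.
      by ring.
    rewrite EFinD; apply: leeD; apply: wdP => //.
    + exact: iota_uniq.
    + exact: base_window_gt0.
    + by rewrite size_base_window expn_gt0.
    + exact: iota_uniq.
    + exact: test_window_gt0.
    + by rewrite size_test_window.
  rewrite size_iota lee_fin.
  have t2 : 2 <= t%:R :> R by rewrite ler_nat.
  have tN : t%:R <= (N t)%:R :> R by rewrite ler_nat leq_maxr.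
  have t0 : 0 < t%:R :> R by lra.
  have -> : 4 * (2 ^+ n)^-1 * (t%:R ^+ 2)^-1 = t%:R * (4 * (2 ^+ n * t%:R ^+ 3)^-1) :> R.
    by rewrite !exprS expr0; field; rewrite !gt_eqF// exprn_gt0.
  apply: ler_wpM2l; first exact: ltW.
  apply: ler_wpM2l => //.
  have N0 : 0 < (N t)%:R :> R by lra.
  rewrite lef_pV2 ?posrE; [|exact: exprn_gt0|by rewrite mulr_gt0// exprn_gt0].
  rewrite -(addn3 n) exprD; apply: ler_pM.
  - exact: exprn_ge0.
  - by apply: exprn_ge0; lra.
  - by apply: lerXn2r; rewrite ?nnegrE; lra.
  - by apply: lerXn2r; rewrite ?nnegrE; lra.
have lowP r : (P (low_moment (2 ^ r) j (c * s2)) <= (q ^+ (2 ^ r))%:E)%E.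
  have szr : size (base_window (2 ^ r)) = (2 ^ r)%N.
    by rewrite size_base_window trunc_expnK.
  have := lowq d T P p Y (base_window (2 ^ r)) j s2 regY indY BY.
  rewrite szr; apply => //.
  - exact: iota_uniq.
  - exact: base_window_gt0.
  - by rewrite expn_gt0.
  - by move=> i /mem_base_window/andP[i0 _]; rewrite SE.
have FP : (P (\bigcup_r F r) <= (2 * q + 4 * (2 ^+ n)^-1)%:E)%E.
  apply: (@probability_bigcup_le _ _ _ P F
    (fun r => q ^+ (2 ^ r) + 4 * (2 ^+ n)^-1 * (r.+2%:R ^+ 2)^-1)) => // r.
    rewrite EFinD; apply: (le_trans (measureU2 _ _ _)) => //.
      exact: measurable_low_moment.
    by apply: leeD; [exact: lowP|exact: badP].
  rewrite big_split /= -mulr_sumr; apply: lerD; first exact: sum_expn2_le.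
  by rewrite ler_piMr ?mulr_ge0 ?invr_ge0 ?exprn_ge0//; exact: sum_inv_sqr_le1.
apply: le_trans FP; apply: le_measure; rewrite ?inE.
- rewrite tauhat_ltyE; apply: bigcup_measurable => t _.
  exact: (measurable_alarm_times p0 lam0 regY).
- exact: bigcup_measurable.
rewrite tauhat_ltyE => x [t _ /= /(alarm_timesP Y p0 lam0)].
move=> [t2 [g [s [gG gt sS [_ al]]]]].
have g0 := grid_gt0 gG; have s0 := Sset_gt0 p0 sS.
apply: contrapT => nF.
have glt : (g <= t)%N by lia.
have nlow : ~ low_moment g j (c * s2) x.
  move=> H; apply: nF; exists (trunc_log 2 g) => //; left.
  by rewrite /low_moment /base_window/= trunc_expnK.
have nbad : ~ (wd t (base_window g) x \/ wd t (test_window t g) x).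
  move=> H; apply: nF; exists (t - 2)%N => //; right.
  rewrite -addn2 subnK//; exists g; last by rewrite glt.
  by rewrite /= mem_iota g0 add1n ltnS.
have L0 : 0 <= ln (N t)%:R :> R.
  by apply: ln_ge0; rewrite ler1n leq_max p0.
have [b1 b2] := good_windows (ltW K0) (level_ge0 n.+3) L0 g0 glt
  (fun h => nbad (or_introl h)) (fun h => nbad (or_intror h)).
set rho := rate _ _ in b1 b2.
have rho0 : 0 <= rho by exact: rate_ge0.
have e0 : 0 <= 3 * (K * (level n.+3 * rho)).
  apply: mulr_ge0 => //; apply: mulr_ge0; first exact: ltW.
  by apply: mulr_ge0 => //; exact: level_ge0.
have up : lhat s (Sig1 Y g x - Sig2 Y t g x) <= s%:R * (3 * (K * (level n.+3 * rho))).
  by apply: lhat_le => // k l; have := b2 k l; rewrite subrr mxE sub0r normrN.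
have sig : c * s2 < sighat2 Y g x.
  apply: (@lt_le_trans _ _ (Sig1 Y g x j j)); last exact: lhat_ge_diag.
  by rewrite Sig1E ltNge; apply/negP.
move: al; rewrite xiE -/rho ltNge => /negP; apply; apply: (le_trans up).
have -> : s%:R * (3 * (K * (level n.+3 * rho))) = (6 * u * level n.+3) * (s2 * (s%:R * rho)).
  by rewrite /K; ring.
have sr0 : 0 <= s%:R * rho by rewrite mulr_ge0.
apply: (@le_trans _ _ (c * lam * (s2 * (s%:R * rho)))).
  by apply: ler_wpM2r => //; apply: mulr_ge0 => //; exact: ltW.
rewrite (_ : c * lam * _ = c * s2 * (lam * s%:R * rho)); last by ring.
by apply: ler_wpM2r (ltW sig); rewrite -mulrA; apply: mulr_ge0 => //; exact: ltW.
Qed.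

End FalseAlarms.

(** * Detection after a change *)

Section Detection.
Context {R : realType} {d : measure_display} {T : measurableType d}.
Variables (P : probability T R) (p : nat) (Y : nat -> 'I_p -> T -> R).
Hypothesis p0 : (0 < p)%N.

(** For [b <= 1] the square-root term decides, since [L / m <= b ^ 2] already forces
    [L / m <= b]. *)
Lemma rate_le (L m b : R) : 0 < m -> 0 <= b <= 1 -> L <= b ^+ 2 * m -> rate L m <= b.
Proof.
move=> m0 /andP[b0 b1] Lb; have Lmb : L / m <= b ^+ 2 by rewrite ler_pdivrMr.
rewrite ge_max; apply/andP; split.
  by rewrite -[leRHS]ger0_norm// -sqrtr_sqr; exact: ler_wsqrtr.
by apply: le_trans Lmb _; rewrite expr2 ler_piMr.
Qed.

(** In units of [M * k * rho]: [6 * u * a] is the deviation lost by the statistic, and the other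
    term is the threshold, with [s <= 2 * k] and the scale estimate at most
    [M * (1 + 4 * u * a)]. *)
Definition detection_const (u lam a : R) : R := 6 * u * a + 2 * lam * (1 + 4 * u * a).

Lemma alarm_good_windows (u lam a : R) (S1 S2 : 'M[R]_p) t g k s x :
    0 < u -> 0 < lam -> 0 <= a -> (0 < k <= s)%N -> (s <= 2 * k)%N ->
    posdef S1 -> posdef S2 ->
    let M := Num.max (lmax k S1) (lmax k S2) in
    let rho := rate (ln (maxn p t)%:R) g%:R in
    (forall i j, `|Sig1 Y g x i j - S1 i j| <= 2 * (2 * u * M * (a * rho))) ->
    (forall i j, `|(S1 - S2) i j - (Sig1 Y g x - Sig2 Y t g x) i j|
       <= 3 * (2 * u * M * (a * rho))) ->
    0 < sighat2 Y g x -> 0 < rho <= 1 ->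
    detection_const u lam a * (k%:R * rho) < omega k S1 S2 ->
  alarm lam Y t g s x.
Proof.
move=> u0 lam0 a0 /andP[k0 ks] s2k pd1 pd2 M rho b1 b2 sig0 /andP[rho0 rho1] D.
have k0R : 0 < k%:R :> R by rewrite ltr0n.
have s0 : (0 < s)%N by exact: leq_trans ks.
have s0R : 0 < s%:R :> R by rewrite ltr0n.
have M0 : 0 < M.
  rewrite lt_max; apply/orP; left.
  exact: lt_le_trans (posdef_diag_gt0 (Ordinal p0) pd1) (lmax_ge_diag _ _ k0).
have ar0 : 0 <= a * rho by rewrite mulr_ge0// ltW.
have e0 : 0 <= 2 * u * M * (a * rho).
  by apply: mulr_ge0 => //; rewrite ltW// !mulr_gt0.
have omE : lmax k (S1 - S2) = omega k S1 S2 * M by rewrite /omega divfK// gt_eqF.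
have low : omega k S1 S2 * M - k%:R * (3 * (2 * u * M * (a * rho)))
    <= lhat s (Sig1 Y g x - Sig2 Y t g x).
  rewrite lerBlDr -omE; apply: lmax_le_lhat => //; first by rewrite k0.
  by rewrite mulr_ge0.
(* At sparsity 1, [lhat] is at most the largest entry in absolute value; for a positive definite
   [S1] the entries are controlled by the diagonal, hence by [M]. *)
have up : sighat2 Y g x <= M + 2 * (2 * u * M * (a * rho)).
  rewrite -[leRHS]mul1r; apply: lhat_le => //.
    by rewrite addr_ge0 ?(ltW M0)// mulr_ge0.
  move=> i j; rewrite -[Sig1 Y g x i j](subrK (S1 i j)) addrC.
  apply: le_trans (ler_normD _ _) _; apply: lerD; last exact: b1.
  apply: posdef_entry_le => // l; rewrite le_max lmax_ge_diag//.
have up2 : sighat2 Y g x <= M * (1 + 4 * u * a).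
  apply: (le_trans up); have uMa : 0 <= u * M * a by rewrite !mulr_ge0// ltW.
  have : u * M * a * rho <= u * M * a * 1 by apply: ler_wpM2l.
  lra.
have s2kR : s%:R <= 2 * k%:R :> R by rewrite -natrM ler_nat.
have thr : sighat2 Y g x * (lam * s%:R * rho)
    <= M * (1 + 4 * u * a) * (lam * (2 * k%:R) * rho).
  apply: ler_pM => //; first exact: ltW.
    by rewrite ltW// !mulr_gt0.
  by rewrite ler_wpM2r ?(ltW rho0)// ler_wpM2l// ltW.
split; first by rewrite xiE -/rho mulr_gt0// !mulr_gt0.
rewrite xiE -/rho; apply: (le_lt_trans thr); apply: lt_le_trans low.
rewrite ltrBrDr.
rewrite [ltLHS](_ : _ = detection_const u lam a * (k%:R * rho) * M).
  by rewrite ltr_pM2r.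
by rewrite /detection_const; ring.
Qed.

(** Origin of [C2]: an alarm needs the rate at g to be at most [b = om / ((D + 1) * k)], that is
    [ln N <= b ^ 2 * g]. Since [g >= h / 4] this costs a factor 4, the square of the 2 in [C2];
    [D + 1] in place of [D] makes the final inequality strict. The failure probability is [q] for
    the scale estimate and [2 * 2 ^ - n] for each of the two windows. *)
Lemma detection_bound (w u lam c q : R) (n tau k : nat) :
    0 < u -> 0 < lam -> 0 < c -> 0 < q <= 2^-1 -> lower_tail w q c ->
    (0 < tau)%N -> model_tau P Y tau w u -> (0 < k <= p)%N ->
    let C2 := (2 * (detection_const u lam (level n.+3) + 1)) ^+ 2 in
    let om := omega k (Sigma P Y 1) (Sigma P Y tau.+1) in
    let Lg := ln (maxn p (2 * tau))%:R in
    C2 * k%:R ^+ 2 * Lg <= tau%:R * om ^+ 2 ->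
  ((1 - (q + 4 * (2 ^+ n)^-1))%:E <=
     P [set x | tauhat lam Y x <=
       (tau%:R + (Num.ceil (C2 * k%:R ^+ 2 * Lg / om ^+ 2))%:~R)%:E])%E.
Proof.
move=> u0 lam0 c0 /andP[q0 q12] lowq tau0 [regY [[indY _] [BY [CY [law1 [law2 [pd1 pd2]]]]]]].
move=> /[dup] kp /andP[k0 _] C2 om Lg hyp.
set S1 := Sigma P Y 1 in pd1 om hyp *; set S2 := Sigma P Y tau.+1 in pd2 om hyp *.
have S1E i : (0 < i <= tau)%N -> Sigma P Y i = S1.
  move=> it; apply: (same_law_Sigma regY) => //; last exact: law1.
  by move: it => /andP[].
have S2E i : (tau < i)%N -> Sigma P Y i = S2.
  by move=> it; apply: (same_law_Sigma regY) => //; [exact: leq_ltn_trans it|exact: law2].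
set a := level n.+3 in C2 hyp *; have a0 : 0 <= a by exact: level_ge0.
set D := detection_const u lam a in C2 hyp *.
have D0 : 0 < D.
  rewrite /D /detection_const; apply: ltr_wpDl.
    by rewrite !mulr_ge0// ltW.
  by rewrite !mulr_gt0// ltr_wpDr// !mulr_ge0// ltW.
have D1 : 0 < D + 1 by rewrite addr_gt0.
have k0R : 0 < k%:R :> R by rewrite ltr0n.
have Lg0 : 0 < Lg.
  rewrite ln_gt0// ltr1n leq_max; apply/orP; right.
  by rewrite mul2n -addnn; exact: (leq_add tau0 tau0).
have C20 : 0 < C2 by rewrite exprn_gt0// mulr_gt0.
have num0 : 0 < C2 * k%:R ^+ 2 * Lg by rewrite !mulr_gt0// exprn_gt0.
set M := Num.max (lmax k S1) (lmax k S2).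
have M0 : 0 < M.
  rewrite lt_max; apply/orP; left.
  exact: lt_le_trans (posdef_diag_gt0 (Ordinal p0) pd1) (lmax_ge_diag _ _ k0).
(* If [om] were 0, the signal hypothesis would bound a positive number by 0; the division defining
   the delay is thus a genuine one. *)
have om0 : 0 < om.
  have om_ge0 : 0 <= om.
    apply: divr_ge0 (ltW M0).
    exact: le_trans (normr_ge0 _) (le_lmax _ (delta_sparse_sphere (Ordinal p0) k0)).
  rewrite lt_neqAle om_ge0 andbT; apply/eqP => omz.
  by move: hyp; rewrite -omz expr0n mulr0 leNgt num0.
have om1 : om <= 1 by exact: omega_le1.
have om2 : 0 < om ^+ 2 by rewrite exprn_gt0.
set h0 := C2 * k%:R ^+ 2 * Lg / om ^+ 2.
have h00 : 0 < h0 by rewrite divr_gt0.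
have h0tau : h0 <= tau%:R by rewrite ler_pdivrMr.
have ceil0 : 0 < Num.ceil h0 by rewrite ceil_gt0.
pose h := `|Num.ceil h0|%N.
have hE : h%:Z = Num.ceil h0 by rewrite /h gez0_abs// ltW.
have h_gt0 : (0 < h)%N by rewrite absz_gt0 gt_eqF.
(* The signal hypothesis says that the unrounded delay is at most [tau], an integer, so rounding up
   preserves it. Hence [2 * h <= t], and a base window with [g <= h] ends no later than [tau]. *)
have htau : (h <= tau)%N by rewrite -lez_nat hE ceil_le_int.
have h0h : h0 <= h%:R by rewrite -[leRHS]/((h%:Z)%:~R) hE; exact: ceil_ge.
have -> : tau%:R + (Num.ceil h0)%:~R = (tau + h)%:R :> R by rewrite -hE natrD.
pose t := (tau + h)%N; have ht : (2 * h <= t)%N by rewrite mul2n -addnn leq_add2r.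
have [g [gG g0 gh hg]] := grid_dense h_gt0 ht.
have gt : (g <= t)%N by exact: leq_trans gh (leq_addl _ _).
have t1 : (1 < t)%N by exact: (leq_add tau0 h_gt0).
have [s [sS ks s2k]] := Sset_dense kp.
pose N := maxn p t.
have N1 : (1 < N)%N by rewrite leq_max t1 orbT.
have L0 : 0 < ln (N%:R : R) by rewrite ln_gt0// ltr1n.
(* From [t = tau + h <= 2 * tau]: this is where the [2 * tau] in the logarithm is used. *)
have LLg : ln N%:R <= Lg.
  rewrite ler_ln ?posrE ?ltr0n ?(ltn_trans _ N1)// ?leq_max ?p0//.
  by rewrite ler_nat geq_max leq_maxl leq_max mul2n -addnn leq_add2l htau orbT.
pose b := om / ((D + 1) * k%:R).
have b0 : 0 < b by rewrite divr_gt0// mulr_gt0.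
have b1 : b <= 1.
  rewrite ler_pdivrMr ?mulr_gt0// mul1r; apply: (le_trans om1).
  have : 1 <= k%:R :> R by rewrite ler1n.
  by nra.
have g0R : 0 < g%:R :> R by rewrite ltr0n.
set rho := rate (ln N%:R) (g%:R : R).
have rhob : rho <= b.
  apply: rate_le => //; first by rewrite b1 ltW.
  apply: (le_trans LLg).
  have -> : Lg = b ^+ 2 * (h0 / 4).
    by rewrite /b /h0 /C2; field; rewrite !gt_eqF.
  rewrite ler_wpM2l ?sqr_ge0// ler_pdivrMr// mulrC; apply: (le_trans h0h).
  by rewrite -natrM ler_nat.
have rho0 : 0 < rho by rewrite /rho lt_max sqrtr_gt0 divr_gt0.
pose wd I S := window_deviation Y I S (2 * u * M * (a * rate (ln N%:R) (size I)%:R)).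
pose j := Ordinal p0.
have s20 : 0 < S1 j j by exact: posdef_diag_gt0.
have wdP I S : uniq I -> all (fun i => 0 < i)%N I -> (0 < size I)%N ->
    (forall i, i \in I -> Sigma P Y i = S) -> posdef S -> (forall l, S l l <= M) ->
    (P (wd I S) <= (2 * (2 ^+ n)^-1)%:E)%E.
  move=> uI I0 szI SI pdS SM.
  apply: le_trans (window_deviation_le regY indY CY u0 n.+3 uI I0 szI SI _ M0 _ N1) _.
  - by move=> l; rewrite SM andbT; exact: posdef_diag_gt0.
  - by rewrite leq_maxl.
  have N2 : 2 <= N%:R :> R by rewrite ler_nat.
  rewrite lee_fin ler_wpM2l// lef_pV2 ?posrE ?exprn_gt0//; last by lra.
  apply: (@le_trans _ _ (2 ^+ n.+3)); first by rewrite ler_weXn2l// ?ler1n// -(addn3 n) leq_addr.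
  by apply: lerXn2r; rewrite ?nnegrE; lra.
have base_le i : i \in base_window g -> (0 < i <= tau)%N.
  move=> /mem_base_window/andP[-> ig] /=; apply: leq_trans (leq_trans gh htau).
  by apply: leq_trans ig _; exact: trunc_logP.
have wd1 : (P (wd (base_window g) S1) <= (2 * (2 ^+ n)^-1)%:E)%E.
  apply: wdP => //; [exact: iota_uniq|exact: base_window_gt0|..].
  - by rewrite size_base_window expn_gt0.
  - by move=> i /base_le; exact: S1E.
  - by move=> l; rewrite le_max lmax_ge_diag.
have wd2 : (P (wd (test_window t g) S2) <= (2 * (2 ^+ n)^-1)%:E)%E.
  apply: wdP => //; [exact: iota_uniq|exact: test_window_gt0|..].
  - by rewrite size_test_window.
  - move=> i /mem_test_window/andP[it _]; apply: S2E; apply: leq_ltn_trans it.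
    by rewrite /t -addnBA// leq_addr.
  - by move=> l; rewrite le_max lmax_ge_diag ?orbT.
(* The lower tail only serves to make the scale estimate positive, since a null threshold raises no
   alarm; one window, an arbitrary coordinate and the crude bound [q] suffice. *)
have lowP : (P (low_moment Y g j (c * S1 j j)) <= q%:E)%E.
  apply: (@le_trans _ _ (q ^+ (size (base_window g)))%:E).
    apply: (lowq d T P p Y (base_window g) j (S1 j j) regY indY BY) => //.
    - exact: iota_uniq.
    - exact: base_window_gt0.
    - by rewrite size_base_window expn_gt0.
    - by move=> i /base_le/S1E ->.
  rewrite lee_fin -[leRHS]expr1 ler_wiXn2l ?(ltW q0)//; first by lra.
  by rewrite size_base_window expn_gt0.
have mw I S : all (fun i => 0 < i)%N I -> measurable (wd I S).
  exact: (measurable_window_deviation regY).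
have mlow : measurable (low_moment Y g j (c * S1 j j)) by exact: (measurable_low_moment _ _ _ regY).
have mw1 := mw _ S1 (base_window_gt0 g); have mw2 := mw _ S2 (test_window_gt0 t g).
apply: (@probability_setC_ge _ _ _ P
  (low_moment Y g j (c * S1 j j) `|` (wd (base_window g) S1 `|` wd (test_window t g) S2))).
- by apply: measurableU => //; exact: measurableU.
- rewrite tauhat_leE; apply: bigcup_measurable => r _.
  exact: (measurable_alarm_times p0 lam0 regY).
- rewrite tauhat_leE => x nx; exists t => //=; apply/(alarm_timesP Y p0 lam0).
  split => //; exists g, s; split => //.
    by apply: leq_trans ht; rewrite leq_mul2l gh.
  have K0 : 0 <= 2 * u * M by rewrite ltW// !mulr_gt0.
  have [B1 B2] := good_windows K0 a0 (ltW L0) g0 gt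
    (fun H => nx (or_intror (or_introl H))) (fun H => nx (or_intror (or_intror H))).
  apply: (@alarm_good_windows u lam a S1 S2 t g k s x) => //.
  - by rewrite k0.
  - apply: (@lt_le_trans _ _ (Sig1 Y g x j j)); last exact: lhat_ge_diag.
    rewrite Sig1E; apply: (@lt_trans _ _ (c * S1 j j)); first exact: mulr_gt0.
    by rewrite ltNge; apply/negP => H; apply: nx; left.
  - by rewrite -/N -/rho rho0 (le_trans rhob).
  - rewrite -/N -/rho -/D -/om.
    have kr : k%:R * rho <= om / (D + 1).
      apply: (@le_trans _ _ (k%:R * b)); first by rewrite ler_wpM2l.
      by rewrite /b le_eqVlt; apply/orP; left; apply/eqP; field; rewrite !gt_eqF.
    apply: (@le_lt_trans _ _ (D * (om / (D + 1)))); first by rewrite ler_wpM2l// ltW.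
    by rewrite mulrA ltr_pdivrMr//; nra.
- apply: (le_trans (measureU2 _ mlow (measurableU _ _ mw1 mw2))).
  rewrite EFinD; apply: leeD => //; apply: (le_trans (measureU2 _ mw1 mw2)).
  rewrite (_ : 4 * _ = 2 * (2 ^+ n)^-1 + 2 * (2 ^+ n)^-1); last by ring.
  by rewrite EFinD; apply: leeD.
Qed.

End Detection.

Theorem theorem4 (R : realType) (w u : R) (hw : 0 < w) (hu : 0 < u)
  (delta : R) (hdelta : 0 < delta < 1) :
  exists C1 : R, 0 < C1 /\
    (forall lam : R, C1 <= lam ->
      forall (p : nat) (d : measure_display) (T : measurableType d)
        (P : probability T R) (Y : nat -> 'I_p -> T -> R),
        (0 < p)%N -> model_infty P Y w u ->
        (P [set x | tauhat lam Y x < +oo] <= delta%:E)%E) /\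
    (forall lam : R, 0 < lam ->
      exists C2 : R, 0 < C2 /\
        forall (p : nat) (d : measure_display) (T : measurableType d)
          (P : probability T R) (Y : nat -> 'I_p -> T -> R) (tau k : nat),
          (0 < p)%N -> (0 < tau)%N -> model_tau P Y tau w u ->
          (0 < k <= p)%N ->
          let om := omega k (Sigma P Y 1) (Sigma P Y tau.+1) in
          let Lg := ln ((maxn p (2 * tau))%:R) in
          C2 * (k%:R) ^+ 2 * Lg <= tau%:R * om ^+ 2 ->
          ((1 - delta)%:E <=
             P [set x | (tauhat lam Y x <=
                (tau%:R + (Num.ceil (C2 * (k%:R) ^+ 2 * Lg / om ^+ 2))%:~R)%:E)%E])%E).
Proof.
have /andP[d0 d1] := hdelta.
(* False alarms cost [2 * q] and [4 * 2 ^ - n], each at most [delta / 2]; detection spends [q] in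
   place of [2 * q]. *)
pose q := delta / 4.
have q0 : 0 < q by rewrite divr_gt0.
have q12 : q <= 2^-1 by rewrite /q; lra.
have q1 : q < 1 by rewrite /q; lra.
have [|c [c0 lowq]] := @second_moment_lower_tail R w q hw; first by rewrite q0.
have [n nE] : exists n, 4 * (2 ^+ n)^-1 <= delta / 2.
  have : 0 < delta / 8 by rewrite divr_gt0.
  move=> /ltr_add_invr[n]; rewrite add0r => nd; exists n.
  have : (2 ^+ n)^-1 <= n.+1%:R^-1 :> R.
    rewrite lef_pV2 ?posrE ?exprn_gt0//.
    by rewrite -natrX ler_nat; exact: ltn_expl.
  by move=> /le_lt_trans/(_ nd); lra.
exists (6 * u * level n.+3 / c).
have lev0 : 0 < level n.+3 :> R by rewrite /level ltr_wpDl// mulr_ge0.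
have C10 : 0 < 6 * u * level n.+3 / c by rewrite divr_gt0// !mulr_gt0.
split => //; split.
  move=> lam lamC p d T P Y p0 modY.
  have lam0 : 0 < lam by exact: lt_le_trans lamC.
  apply: le_trans (@false_alarm_bound R d T P p Y p0 w u lam c q n _ _ _ _ lowq _ modY) _ => //.
  - by rewrite q0.
  - by rewrite [leRHS]mulrC -ler_pdivrMr.
  - by rewrite lee_fin /q; lra.
move=> lam lam0; exists ((2 * (detection_const u lam (level n.+3) + 1)) ^+ 2); split.
  rewrite exprn_gt0// mulr_gt0// ltr_wpDl// /detection_const.
  by rewrite addr_ge0// !mulr_ge0 ?addr_ge0 ?mulr_ge0// ltW.
move=> p d T P Y tau k p0 tau0 modY kp om Lg hyp.
apply: le_trans (@detection_bound R d T P p Y p0 w u lam c q n tau k hu lam0 c0 _ lowq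
  tau0 modY kp hyp); last by rewrite q0.
by rewrite lee_fin /q; lra.
Qed.
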